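(* Let $k$ be a real quadratic field with ring of integers $\mathcal{O}$ and real embeddings $\iota_1$ (the inclusion $k\subset\mathbb{R}$) and $\iota_2$. Let $I$ be a fractional ideal of $k$ and $\xi$ a character of the additive group $I$ with values in the complex roots of unity, whose annihilator $\mathfrak{f}=\{a\in\mathcal{O}:\xi(ax)=1\ \forall x\in I\}$ satisfies $\mathfrak{f}\neq\mathcal{O}$; let $f\in\mathbb{Z}_{>0}$ be defined by $\mathfrak{f}\cap\mathbb{Z}=f\mathbb{Z}$ and let $\mu_f$ denote the group of $f$-th roots of unity in $\mathbb{C}$. Suppose that $\tau_1,\tau_2$ are two $\mathbb{Q}$-linearly independent totally positive elements of $I$ with $\xi(\tau_1)\neq1$ and $\xi(\tau_2)\neq 1$. Then for any coset $A\in I/(\mathbb{Z}\tau_1+\mathbb{Z}\tau_2)$: (1) the series $z(s;\xi,A,\tau_1,\tau_2)$ converges absolutely for $\Re(s)>1$ and possesses a meromorphic continuation to $\mathbb{C}$; (2) for each $m\in\mathbb{Z}_{\leq 0}$ this continuation is analytic at $s=m$ and, for either choice of ordered pair $\underline{\iota}\in\{(\iota_1,\iota_2),(\iota_2,\iota_1)\}$, $$z(m;\xi,A,\tau_1,\tau_2)=\Delta^{-m}\big|_{\underline{X}=0}\,F_{\underline{\iota}}(\underline{X};\xi,A,\tau_1,\tau_2);$$ (3) $z(m;\xi,A,\tau_1,\tau_2)\in\mathbb{Q}(\mu_f)$ for all $m\in\mathbb{Z}_{\leq 0}$.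
   Context: Totally positive means positive under both real embeddings. Define the half-open parallelogram $P(\tau_1,\tau_2)=\{\lambda\tau_1+\mu\tau_2:\lambda,\mu\in\mathbb{Q},\ 0<\lambda\le 1,\ 0\le\mu<1\}$ and the cone $C(\tau_1,\tau_2)=\{\lambda\tau_1+\mu\tau_2:\lambda,\mu\in\mathbb{Q},\ 0<\lambda,\ 0\le\mu\}$. For a coset $A\in I/(\mathbb{Z}\tau_1+\mathbb{Z}\tau_2)$ let $\tilde a$ be the unique element of $A\cap P(\tau_1,\tau_2)$, so $A\cap C(\tau_1,\tau_2)=\tilde a+\mathbb{N}\tau_1+\mathbb{N}\tau_2$. Define $$z(s;\xi,A,\tau_1,\tau_2)=\sum_{a\in A\cap C(\tau_1,\tau_2)}\frac{\xi(a)}{(\iota_1(a)\iota_2(a))^s}.$$ Let $\underline{X}=(X_1,X_2)$ be formal variables; for $\underline{u}=(u_1,u_2)\in\mathbb{R}^2$ write $(1+\underline{X})^{\underline{u}}=(1+X_1)^{u_1}(1+X_2)^{u_2}$ (product of formal binomial series), and for $\underline\iota=(\iota_{\pi(1)},\iota_{\pi(2)})$ write $\underline{\iota}(a)=(\iota_{\pi(1)}(a),\iota_{\pi(2)}(a))$. Define the formal power series $$F_{\underline{\iota}}(\underline{X};\xi,A,\tau_1,\tau_2)=\frac{\xi(\tilde a)(1+\underline{X})^{\underline{\iota}(\tilde a)}}{(1-\xi(\tau_1)(1+\underline{X})^{\underline{\iota}(\tau_1)})(1-\xi(\tau_2)(1+\underline{X})^{\underline{\iota}(\tau_2)})}$$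 (a power series since the constant term of the denominator is nonzero). Let $\Delta=(1+X_1)(1+X_2)\frac{\partial^2}{\partial X_1\partial X_2}$, and $\Delta^{-m}|_{\underline X=0}$ means apply $\Delta$ $(-m)$ times and take the constant term. *)

(* Defs.v *)
From HB Require Import structures.
From mathcomp Require Import all_boot all_order all_algebra all_field.
From mathcomp Require Import finmap zify lra.
From mathcomp Require Export all_classical all_reals all_analysis.
From mathcomp Require Export complex.

Set Implicit Arguments.
Unset Strict Implicit.
Unset Printing Implicit Defensive.

Import Order.TTheory GRing.Theory Num.Theory.
Import numFieldNormedType.Exports.

Local Open Scope classical_set_scope.
Local Open Scope ring_scope.

(* A character of the additive group I is a total function xi on k of which
   only the values on I matter. *)

Section QuadraticField.
Variable k : fieldExtType rat.
Implicit Types (I A : set k) (x a t : k).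

Definition ring_of_integers : set k :=
  [set x | integralOver (intr : int -> k) x].

Record fractional_ideal I : Prop := FractionalIdeal {
  fid_sub : forall x y, I x -> I y -> I (x - y);
  fid_mul : forall a x, ring_of_integers a -> I x -> I (a * x);
  fid_neq0 : exists2 x, I x & x != 0;
  fid_denom : exists2 d, ring_of_integers d /\ d != 0 &
    forall x, I x -> ring_of_integers (d * x)
}.

Definition lattice_coset I (t1 t2 : k) A : Prop :=
  exists2 a, I a & A = [set a + (t1 *~ p + t2 *~ q) | p in setT & q in setT].

Definition parallelogram (t1 t2 : k) : set k :=
  [set x | exists l m : rat,
    [/\ 0 < l <= 1, 0 <= m < 1 & x = l *: t1 + m *: t2]].

Definition cone (t1 t2 : k) : set k :=
  [set x | exists l m : rat, [/\ 0 < l, 0 <= m & x = l *: t1 + m *: t2]].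

(* When A is a coset of Z t1 + Z t2 and t1, t2 are linearly independent, the
   intersection is a singleton and this is its element. *)
Definition coset_repr A (t1 t2 : k) : k := xget 0 (A `&` parallelogram t1 t2).

Variable R : realType.
Implicit Types (xi : k -> R[i]) (iota : {rmorphism k -> R}).

Definition totally_positive iota1 iota2 t : Prop :=
  0 < iota1 t /\ 0 < iota2 t.

Record torsion_character I xi : Prop := TorsionCharacter {
  tchar_add : forall x y, I x -> I y -> xi (x + y) = xi x * xi y;
  tchar_root : forall x, I x -> exists2 n, (0 < n)%N & xi x ^+ n = 1
}.

Definition annihilator I xi : set k :=
  [set a | ring_of_integers a /\ forall x, I x -> xi (a * x) = 1].

(* x ^ s = exp (s ln x), for x > 0. *)
Definition cpow (x : R) (s : R[i]) : R[i] :=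
  let th := complex.Im s * ln x in
  ((expR (complex.Re s * ln x))%:C * (cos th +i* sin th))%C.

Definition zeta_term iota1 iota2 xi (s : R[i]) a : R[i] :=
  xi a / cpow (iota1 a * iota2 a) s.

End QuadraticField.

Arguments ring_of_integers : clear implicits.

Lemma coset_reprP (k : fieldExtType rat) (I A : set k) (t1 t2 : k) :
  \dim {:k} = 2%N -> free [:: t1; t2] -> lattice_coset I t1 t2 A ->
  A `&` parallelogram t1 t2 = [set coset_repr A t1 t2].
Proof.
move=> dk fr [a _ ->]; set B := image2 _ _ _.
have coordE x : exists l m : rat, x = l *: t1 + m *: t2.
  have sp : basis_of fullv [:: t1; t2] by rewrite basisEfree fr subvf dk.
  have : x \in <<[:: t1; t2]>>%VS by rewrite (span_basis sp) memvf.
  rewrite span_cons span_seq1 => /memv_addP[u /vlineP[l ->] [v /vlineP[m ->] ->]].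
  by exists l, m.
have coord_inj l m l' m' :
    l *: t1 + m *: t2 = l' *: t1 + m' *: t2 -> l = l' /\ m = m'.
  move=> e; pose F (i : 'I_2) := if i == 0 then l - l' else m - m'.
  have F0 : \sum_(i < 2) F i *: [tuple t1; t2]`_i = 0.
    rewrite big_ord_recl big_ord1 /F /= !scalerBl addrACA -opprD e.
    by rewrite subrr.
  have /freeP/(_ F F0) Fi : free [tuple t1; t2] by [].
  by split; apply/eqP; rewrite -subr_eq0; apply/eqP; [exact: (Fi 0)|exact: (Fi 1)].
have zE (p : int) t : t *~ p = p%:~R *: t :> k by rewrite scaler_int.
have ex : exists x, (B `&` parallelogram t1 t2) x.
  have [l [m aE]] := coordE a.
  pose p : int := 1 - Num.ceil l; pose q : int := - Num.floor m.
  exists (a + (t1 *~ p + t2 *~ q)); split; first by exists p => //; exists q.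
  exists (l + p%:~R), (m + q%:~R); split.
  - have := ceil_itv l; rewrite /p !rmorphB /=; lra.
  - have := floor_itv m; rewrite /q rmorphN rmorphD /=; lra.
  - by rewrite aE !zE !scalerDl addrACA.
have px := xgetPex 0 ex.
apply/seteqP; split => [x|x ->]; last exact: px.
rewrite /coset_repr => -[Bx Px]; move: px; set y := xget _ _ => -[By Py] /=.
case: Bx => p _ [q _ xE]; case: By => p' _ [q' _ yE].
case: Px => l [m [/andP[l0 l1] /andP[m0 m1] xE']].
case: Py => l' [m' [/andP[l'0 l'1] /andP[m'0 m'1] yE']].
have : (l - l') *: t1 + (m - m') *: t2 = (p - p')%:~R *: t1 + (q - q')%:~R *: t2.
  rewrite !rmorphB /= !scalerBl !(addrACA _ (- _)) -!opprD -xE' -yE' -xE -yE !zE.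
  by rewrite [a + _]addrC addrKA.
move=> /coord_inj[lE mE].
have small (z : int) : -1 < (z%:~R : rat) < 1 -> z = 0.
  by rewrite -[-1]/((-1)%:~R) -[1]/(1%:~R) !ltr_int; lia.
have pp : p - p' = 0 by apply: small; rewrite -lE; apply/andP; split; lra.
have qq : q - q' = 0 by apply: small; rewrite -mE; apply/andP; split; lra.
by rewrite -xE -yE; congr (_ + (_ *~ _ + _ *~ _)); apply/eqP; rewrite -subr_eq0 ?pp ?qq.
Qed.

Section Analysis.
Variable R : realType.

Definition abs_summable (T : choiceType) (D : set T) (g : T -> R[i]) : Prop :=
  summable D (fun x => (Normc.normc (g x))%:E).

(* Unordered summation: convergence along the directed set of finite subsets
   of D. *)
Definition has_sum (T : choiceType) (D : set T) (g : T -> R[i]) (S : R[i]) :=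
  forall e : R, 0 < e ->
    exists2 X0 : {fset T}, [set` X0] `<=` D &
      forall X : {fset T}, [set` X0] `<=` [set` X] -> [set` X] `<=` D ->
        Normc.normc (S - \sum_(x <- X) g x) < e.

(* The topology is that of R[i]^o; derivability in the direction 1 is
   complex differentiability. *)
Definition analytic_at (g : R[i] -> R[i]) (z0 : R[i]) : Prop :=
  \forall z \near (z0 : R[i]^o), derivable (g : R[i]^o -> R[i]^o) z 1.

Definition pole_at (g : R[i] -> R[i]) (z0 : R[i]) : Prop :=
  exists n : nat, exists h : R[i] -> R[i],
    [/\ (0 < n)%N, analytic_at h z0, h z0 != 0 &
      \forall z \near (z0 : R[i]^o)^', g z = h z / (z - z0) ^+ n].

(* The value of g at a pole is irrelevant. *)
Definition meromorphic (g : R[i] -> R[i]) : Prop :=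
  forall z0, analytic_at g z0 \/ pole_at g z0.

Definition in_cyclotomic_field (f : nat) (z : R[i]) : Prop :=
  forall S : {pred R[i]}, GRing.divring_closed S ->
    (forall w, w ^+ f = 1 -> w \in S) -> z \in S.

End Analysis.

(* Formal power series in X_1, X_2, given by their coefficients. *)
Definition fps2 (K : Type) : Type := nat -> nat -> K.

Section PowerSeries.
Variable K : fieldType.
Implicit Types p q : fps2 K.

Definition fps2C (c : K) : fps2 K := fun i j => c *+ ((i == 0%N) && (j == 0%N)).

Definition fps2_sub p q : fps2 K := fun i j => p i j - q i j.

Definition fps2_mul p q : fps2 K := fun i j =>
  \sum_(a < i.+1) \sum_(b < j.+1) p a b * q (i - a)%N (j - b)%N.

Definition fps2_exp p n : fps2 K := iter n (fps2_mul p) (fps2C 1).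

(* Geometric series: with c the constant term of p, the inverse of p is
   c^-1 times the sum of the (1 - p / c)^n, and (1 - p / c)^n has no
   term of total degree less than n. *)
Definition fps2_inv p : fps2 K := fun i j =>
  let c := p 0%N 0%N in
  c^-1 * \sum_(n < (i + j).+1)
           fps2_exp (fps2_sub (fps2C 1) (fps2_mul (fps2C c^-1) p)) n i j.

Let eqt N (P : {poly {poly K}}) p :=
  forall i j, (i < N)%N -> (j < N)%N -> P`_i`_j = p i j.

Let eqtM N P Q p q : eqt N P p -> eqt N Q q -> eqt N (P * Q) (fps2_mul p q).
Proof.
move=> Pp Qq i j iN jN; rewrite coefM coef_sum; apply: eq_bigr => a _.
rewrite coefM; apply: eq_bigr => b _.
case: a b => [a /= ai] [b /= bj]; rewrite Pp ?Qq //; lia.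
Qed.

Let eqtC N c : eqt N c%:P%:P (fps2C c).
Proof.
by move=> i j _ _; rewrite coefC /fps2C; case: (i == 0%N); rewrite ?coef0// coefC; case: eqP.
Qed.

Let eqtX N P p n : eqt N P p -> eqt N (P ^+ n) (fps2_exp p n).
Proof.
move=> Pp; elim: n => [|n IH]; first exact: eqtC.
by rewrite exprS; apply: eqtM.
Qed.

Let exp_eq0 p n i j : p 0%N 0%N = 0 -> (i + j < n)%N -> fps2_exp p n i j = 0.
Proof.
move=> p0; elim: n i j => [//|n IH] i j ijn.
rewrite [fps2_exp _ _]/(fps2_mul p (fps2_exp p n)) /fps2_mul big1// => a _; rewrite big1// => b _.
have [/andP[/eqP-> /eqP->]|ab] := boolP ((val a == 0%N) && (val b == 0%N)).
  by rewrite p0 mul0r.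
case: a b ab => [a /= ai] [b /= bj] ab; rewrite IH ?mulr0//.
by lia.
Qed.

Lemma fps2_mulV p : p 0%N 0%N != 0 -> fps2_mul p (fps2_inv p) = fps2C 1.
Proof.
move=> c0; apply/funext => i; apply/funext => j.
pose N := (maxn i j).+1.
pose P : {poly {poly K}} := \poly_(i < N) \poly_(j < N) p i j.
have Pp : eqt N P p by move=> a b aN bN; rewrite /P coef_poly aN coef_poly bN.
set c := p 0%N 0%N in c0.
set r := fps2_sub (fps2C 1) (fps2_mul (fps2C c^-1) p).
pose E : {poly {poly K}} := 1 - c^-1%:P%:P * P.
have Er : eqt N E r.
  move=> a b aN bN; rewrite /E !coefB /r /fps2_sub.
  by rewrite (eqtM (@eqtC N _) Pp)// (@eqtC N 1).
have r0 : r 0%N 0%N = 0.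
  rewrite -Er// /E !coefB coefCM coefCM Pp// !coef1 /=.
  by rewrite mulVf// subrr.
pose M := (N + N)%N.
pose Q := c^-1%:P%:P * \sum_(n < M) E ^+ n.
have QV : eqt N Q (fps2_inv p).
  move=> a b aN bN; rewrite /Q !coefCM /fps2_inv -/c -/r; congr (_ * _).
  rewrite 2!coef_sum [RHS](big_ord_widen M (fun n => fps2_exp r n a b)); last first.
    by rewrite /M; lia.
  rewrite [RHS]big_mkcond; apply: eq_bigr => n _; rewrite (eqtX _ Er)//.
  by case: ltnP => // abn; rewrite exp_eq0.
have iN : (i < N)%N by rewrite /N; lia.
have jN : (j < N)%N by rewrite /N; lia.
rewrite -(eqtM Pp QV)// /Q.
have -> : P * (c^-1%:P%:P * \sum_(n < M) E ^+ n) = 1 - E ^+ M.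
  rewrite mulrA [P * _]mulrC.
  have -> : c^-1%:P%:P * P = 1 - E by rewrite /E subKr.
  by rewrite -[1 - E]opprB mulNr -subrX1 opprB.
rewrite !coefB (eqtX _ Er)// exp_eq0 ?subr0 //; first by rewrite (@eqtC N 1).
by rewrite /M; lia.
Qed.
Definition binomial_coef (u : K) (n : nat) : K :=
  (\prod_(i < n) (u - i%:R)) / n`!%:R.

Definition fps2_1DX1 : fps2 K := fun i j => ((i <= 1)%N && (j == 0%N))%:R.
Definition fps2_1DX2 : fps2 K := fun i j => ((i == 0%N) && (j <= 1)%N)%:R.

Definition fps2_d1 p : fps2 K := fun i j => p i.+1 j *+ i.+1.
Definition fps2_d2 p : fps2 K := fun i j => p i j.+1 *+ j.+1.

Definition fps2_Delta p : fps2 K :=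
  fps2_mul (fps2_mul fps2_1DX1 fps2_1DX2) (fps2_d1 (fps2_d2 p)).

(* (1 + X_1)^u.1 (1 + X_2)^u.2 *)
Definition fps2_1DXpow (u : K * K) : fps2 K := fun i j =>
  binomial_coef u.1 i * binomial_coef u.2 j.

End PowerSeries.

Section ShintaniSeries.
Variables (k : fieldExtType rat) (R : realType).

Definition shintani_series (ia ib : {rmorphism k -> R}) (xi : k -> R[i])
    (A : set k) (t1 t2 : k) : fps2 R[i] :=
  let X a := fps2_1DXpow ((ia a)%:C%C, (ib a)%:C%C) in
  let at_ := coset_repr A t1 t2 in
  let den t := fps2_sub (fps2C 1) (fps2_mul (fps2C (xi t)) (X t)) in
  fps2_mul (fps2_mul (fps2C (xi at_)) (X at_))
           (fps2_inv (fps2_mul (den t1) (den t2))).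

End ShintaniSeries.

(* Main.v *)
(** Along the cone the terms are [xi(a~) z1^p z2^q N(a~ + p t1 + q t2)^-s] with
    [z1 = xi(t1)] and [z2 = xi(t2)] different from 1.  Summation by parts, J times in each
    variable, divides by [((1 - z1)(1 - z2))^J] and replaces the norm power by its J-th
    mixed backward difference, which gains a factor [(p + q + 1)^-J]; so the transformed
    series converges absolutely as soon as J is large compared with [|s|].  A quadratic
    estimate of the remainder of [s |-> N^-s], which decays at the same rate, shows
    that the resulting function of s is entire.
    At [s = -M] the coefficient of [X^0] in [Delta^M ((1 + X)^u)] is [(u_1 u_2)^M], so
    the norm powers are the images under the linear form [Delta^M |_(X = 0)] of
    [W U^p V^q] with [W], [U], [V] the series [(1 + X)^a~], [(1 + X)^t1], [(1 + X)^t2].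
    The same summation by parts, applied to the powers of [U] and [V], sums the geometric series
    to the Shintani series, up to multiples of [(U - 1)^J] and [(V - 1)^J], which the
    linear form kills.  Then only finitely many differences are nonzero,
    which also gives rationality over the f-th roots of unity. *)

Require Import Defs.
From mathcomp Require Import all_boot all_order all_algebra all_field.
From mathcomp Require Import finmap zify ring lra.
From mathcomp Require Import all_classical all_reals all_analysis complex.

Import Order.TTheory GRing.Theory Num.Theory.
Import numFieldNormedType.Exports.
Local Open Scope classical_set_scope.
Local Open Scope ring_scope.

(** The hinge is uniqueness of the regularized sum: since neither character value is 1, the number
    obtained after [J] summations by parts does not depend on [J]. The ordinary sum for real part
    above 1, the values of the continuation near a point and the finite algebraic sum at [s = -M]
    are therefore regularized values of one family of grids, and are compared directly. The obstacle
    is the boundary of the quadrant. Grids are extended by 0 to negative indices, so that a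
    difference multiplies the sum by exactly [1 - z]; but then [J] differences in [p] follow a
    smooth function only for [p >= J]. Hence the decay is taken from differences in the larger of
    [p] and [q]: where even the larger index is below [J] only finitely many points remain, and the
    differences in the other variable are bounded by the triangle inequality alone. The estimates
    are uniform in the function of the logarithm of the norm, because they are applied to a Taylor
    remainder with a varying parameter [v] and must keep its factor [|v|^2]. *)

Local Notation normc := Normc.normc.

Set Implicit Arguments.
Unset Strict Implicit.
Unset Printing Implicit Defensive.


(** * The modulus of a complex number, as a real number *)

Section ComplexNorm.
Variable R : realType.
Implicit Types z w : R[i].

Lemma norm_normc z : `|z| = (normc z)%:C%C.
Proof. by case: z => a b; rewrite normc_def. Qed.

Lemma normc_ge0 z : 0 <= normc z.
Proof. by case: z => a b; apply: sqrtr_ge0. Qed.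

Lemma normc_real (a : R) : normc a%:C%C = `|a|.
Proof. by rewrite /= expr0n addr0 sqrtr_sqr. Qed.

Lemma normcX z n : normc (z ^+ n) = normc z ^+ n.
Proof.
elim: n => [|n IH]; first by rewrite !expr0 Normc.normc1.
by rewrite !exprS Normc.normcM IH.
Qed.

Lemma ler_normcD z w : normc (z + w) <= normc z + normc w.
Proof. exact: le_normcD. Qed.

Lemma ler_normcB z w : normc (z - w) <= normc z + normc w.
Proof. by rewrite (le_trans (ler_normcD _ _))// normcN. Qed.

Lemma ler_normc_sum (J : Type) (s : seq J) (P : pred J) (F : J -> R[i]) :
  normc (\sum_(j <- s | P j) F j) <= \sum_(j <- s | P j) normc (F j).
Proof.
elim/big_ind2: _ => [|z u w v zu wv|//]; first by rewrite Normc.normc0.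
by rewrite (le_trans (ler_normcD _ _))// lerD.
Qed.

Lemma Re_le_normc z : `|complex.Re z| <= normc z.
Proof.
case: z => a b /=; rewrite -sqrtr_sqr ler_wsqrtr// lerDl; exact: sqr_ge0.
Qed.

Lemma Im_le_normc z : `|complex.Im z| <= normc z.
Proof.
case: z => a b /=; rewrite -sqrtr_sqr ler_wsqrtr// lerDr; exact: sqr_ge0.
Qed.

Lemma normc_le_ReIm z : normc z <= `|complex.Re z| + `|complex.Im z|.
Proof.
case: z => a b; have -> : (a +i* b)%C = a%:C%C + (0 +i* b)%C.
  by apply/eqP; rewrite eq_complex /= addr0 add0r !eqxx.
rewrite (le_trans (ler_normcD _ _))// normc_real /= expr0n add0r sqrtr_sqr.
by rewrite addr0 add0r.
Qed.

Lemma normc_lt_eq0 z : (forall e, 0 < e -> normc z < e) -> z = 0.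
Proof.
move=> h; apply: Normc.eq0_normc; apply/eqP; case: ltgtP (normc_ge0 z) => // z0 _.
by have := h _ z0; rewrite ltxx.
Qed.

End ComplexNorm.

(** * Double series and their rectangular partial sums *)

Section DoubleSeries.

Definition rsum (V : nmodType) (h : nat -> nat -> V) (a b : nat) : V :=
  \sum_(p < a) \sum_(q < b) h p q.

Lemma rsumD (V : nmodType) (h1 h2 : nat -> nat -> V) a b :
  rsum (fun p q => h1 p q + h2 p q) a b = rsum h1 a b + rsum h2 a b.
Proof.
by rewrite /rsum -big_split; apply: eq_bigr => p _; rewrite -big_split.
Qed.

Lemma rsumM (V : pzRingType) (c : V) (h : nat -> nat -> V) a b :
  rsum (fun p q => c * h p q) a b = c * rsum h a b.
Proof. by rewrite /rsum mulr_sumr; apply: eq_bigr => p _; rewrite mulr_sumr. Qed.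

Lemma eq_rsum (V : nmodType) (h1 h2 : nat -> nat -> V) a b :
  (forall p q, (p < a)%N -> (q < b)%N -> h1 p q = h2 p q) ->
  rsum h1 a b = rsum h2 a b.
Proof. by move=> h; apply: eq_bigr => p _; apply: eq_bigr => q _; apply: h. Qed.

Lemma rsumB (V : zmodType) (h1 h2 : nat -> nat -> V) a b :
  rsum (fun p q => h1 p q - h2 p q) a b = rsum h1 a b - rsum h2 a b.
Proof.
by rewrite /rsum -sumrB; apply: eq_bigr => p _; rewrite -sumrB.
Qed.

Lemma rsum_widen (V : nmodType) (h : nat -> nat -> V) a b a' b' :
  (a <= a')%N -> (b <= b')%N ->
  rsum h a b = rsum (fun p q => if (p < a)%N && (q < b)%N then h p q else 0) a' b'.
Proof.
move=> aa bb; rewrite /rsum (big_ord_widen a' (fun p => \sum_(q < b) h p q))//.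
rewrite big_mkcond; apply: eq_bigr => p _; case: ifP => _ /=; last by rewrite big1.
by rewrite (big_ord_widen b' (fun q => h p q))// big_mkcond.
Qed.

Variable R : realType.
Implicit Types (h : nat -> nat -> R[i]) (r : nat -> nat -> R).

Lemma ler_rsum r1 r2 a b : (forall p q, r1 p q <= r2 p q) ->
  rsum r1 a b <= rsum r2 a b.
Proof. by move=> h; apply: ler_sum => p _; apply: ler_sum. Qed.

Lemma ler_rsum_widen r a b a' b' : (forall p q, 0 <= r p q) ->
  (a <= a')%N -> (b <= b')%N -> rsum r a b <= rsum r a' b'.
Proof.
by move=> r0 aa bb; rewrite (rsum_widen _ aa bb); apply: ler_rsum => p q; case: ifP.
Qed.

Lemma ler_normc_rsum h a b :
  normc (rsum h a b) <= rsum (fun p q => normc (h p q)) a b.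
Proof.
rewrite (le_trans (ler_normc_sum _ _ _))//; apply: ler_sum => p _.
exact: ler_normc_sum.
Qed.

(** The two sides of the rectangle grow independently, so that shifting one variable, which changes
    only one side, preserves convergence. *)
Definition dsum_cvg h (S : R[i]) := forall e : R, 0 < e ->
  exists N, forall a b, (N <= a)%N -> (N <= b)%N -> normc (S - rsum h a b) < e.

(** Squares suffice, since the terms are nonnegative and every rectangle lies in a square. The bound
    is kept explicit because the derivative estimate needs its dependence on a parameter. *)
Definition l1_bound h (M : R) :=
  forall N, rsum (fun p q => normc (h p q)) N N <= M.

Definition l1 h := exists M, l1_bound h M.

Lemma dsum_cvg_ext h1 h2 S : (forall p q, h1 p q = h2 p q) ->
  dsum_cvg h1 S -> dsum_cvg h2 S.
Proof.
move=> hh h1S e e0; have [N HN] := h1S _ e0; exists N => a b Na Nb.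
by rewrite -(eq_rsum (h1 := h1)) ?HN.
Qed.

Lemma dsum_cvg_uniq h S S' : dsum_cvg h S -> dsum_cvg h S' -> S = S'.
Proof.
move=> hS hS'; apply/eqP; rewrite -subr_eq0; apply/eqP/normc_lt_eq0 => e e0.
have e2 : 0 < e / 2 by rewrite divr_gt0.
have [N HN] := hS _ e2; have [N' HN'] := hS' _ e2.
set a := maxn N N'; have := HN a a (leq_maxl _ _) (leq_maxl _ _).
have := HN' a a (leq_maxr _ _) (leq_maxr _ _); set T := rsum _ _ _ => h1 h2.
have -> : S - S' = (S - T) - (S' - T) by rewrite opprB addrA subrK.
by rewrite (le_lt_trans (ler_normcB _ _))//; lra.
Qed.

Lemma dsum_cvgD h1 h2 S1 S2 : dsum_cvg h1 S1 -> dsum_cvg h2 S2 ->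
  dsum_cvg (fun p q => h1 p q + h2 p q) (S1 + S2).
Proof.
move=> H1 H2 e e0; have e2 : 0 < e / 2 by rewrite divr_gt0.
have [N HN] := H1 _ e2; have [N' HN'] := H2 _ e2.
exists (maxn N N') => a b; rewrite !geq_max => /andP[Na Na'] /andP[Nb Nb'].
rewrite rsumD opprD addrACA (le_lt_trans (ler_normcD _ _))//.
by have := HN _ _ Na Nb; have := HN' _ _ Na' Nb'; lra.
Qed.

Lemma dsum_cvgM c h S : dsum_cvg h S -> dsum_cvg (fun p q => c * h p q) (c * S).
Proof.
move=> H e e0; have c0 := normc_ge0 c.
have [|N HN] := H (e / (normc c + 1)); first by rewrite divr_gt0// ltr_wpDl.
exists N => a b Na Nb; rewrite rsumM -mulrBr Normc.normcM.
have := HN _ _ Na Nb; rewrite ltr_pdivlMr ?ltr_wpDl// => /(le_lt_trans _); apply.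
by rewrite mulrC ler_wpM2l ?normc_ge0// lerDl.
Qed.

Lemma dsum_cvgB h1 h2 S1 S2 : dsum_cvg h1 S1 -> dsum_cvg h2 S2 ->
  dsum_cvg (fun p q => h1 p q - h2 p q) (S1 - S2).
Proof.
move=> H1 /(dsum_cvgM (-1)) H2; rewrite -[- S2]mulN1r.
by apply: dsum_cvg_ext (dsum_cvgD H1 H2) => p q; rewrite mulN1r.
Qed.

Lemma l1_boundD h1 h2 M1 M2 : l1_bound h1 M1 -> l1_bound h2 M2 ->
  l1_bound (fun p q => h1 p q + h2 p q) (M1 + M2).
Proof.
move=> H1 H2 N; rewrite (le_trans _ (lerD (H1 N) (H2 N)))// -rsumD.
by apply: ler_rsum => p q; apply: ler_normcD.
Qed.

Lemma l1_boundM c h M : l1_bound h M ->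
  l1_bound (fun p q => c * h p q) (normc c * M).
Proof.
move=> H N; rewrite (le_trans _ (ler_wpM2l (normc_ge0 c) (H N)))// -rsumM.
by apply: ler_rsum => p q; rewrite Normc.normcM.
Qed.

Lemma l1D h1 h2 : l1 h1 -> l1 h2 -> l1 (fun p q => h1 p q + h2 p q).
Proof. by move=> [M ?] [M' ?]; exists (M + M'); apply: l1_boundD. Qed.

Lemma l1M c h : l1 h -> l1 (fun p q => c * h p q).
Proof. by move=> [M ?]; exists (normc c * M); apply: l1_boundM. Qed.

Lemma le_l1_bound h1 h2 M : (forall p q, normc (h1 p q) <= normc (h2 p q)) ->
  l1_bound h2 M -> l1_bound h1 M.
Proof. by move=> hh H N; rewrite (le_trans _ (H N))//; apply: ler_rsum. Qed.

Lemma le_l1 h1 h2 : (forall p q, normc (h1 p q) <= normc (h2 p q)) ->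
  l1 h2 -> l1 h1.
Proof. by move=> hh [M HM]; exists M; apply: le_l1_bound HM. Qed.

Lemma dsum_cvg_le h S M : l1_bound h M -> dsum_cvg h S -> normc S <= M.
Proof.
move=> HM HS; apply/ler_addgt0Pr => e e0; have [N HN] := HS _ e0.
have := HN N N (leqnn _) (leqnn _); have := ler_normc_rsum h N N.
have := HM N; have := ler_normcD (S - rsum h N N) (rsum h N N).
by rewrite subrK; lra.
Qed.

(** The sum is the supremum of the square partial sums: a large rectangle contains a nearly optimal
    square and is contained in another square. *)
Let rsum_nneg_cvg r M : (forall p q, 0 <= r p q) -> (forall N, rsum r N N <= M) ->
  exists S, forall e : R, 0 < e -> exists N, forall a b,
    (N <= a)%N -> (N <= b)%N -> `|S - rsum r a b| < e.
Proof.
move=> r0 rM; pose E := [set rsum r N N | N in [set: nat]].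
have supE : has_sup E.
  by split; [exists (rsum r 0 0), 0%N|exists M => _ [N _ <-]].
exists (sup E) => e e0; have [_ [N _ <-] HN] := sup_adherent e0 supE.
exists N => a b Na Nb; have lo := ler_rsum_widen r0 Na Nb.
have hi : rsum r a b <= sup E.
  apply: (@le_trans _ _ (rsum r (maxn a b) (maxn a b))).
    by apply: ler_rsum_widen; rewrite ?leq_maxl ?leq_maxr.
  by apply: ub_le_sup; [case: supE|exists (maxn a b)].
by rewrite ger0_norm ?subr_ge0//; lra.
Qed.

(** [r] is the difference of the nonnegative series [|r| + r] and [|r|]. *)
Let rsum_abs_cvg r M : (forall N, rsum (fun p q => `|r p q|) N N <= M) ->
  exists S, forall e : R, 0 < e -> exists N, forall a b,
    (N <= a)%N -> (N <= b)%N -> `|S - rsum r a b| < e.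
Proof.
move=> rM; have [S1 H1] := rsum_nneg_cvg (fun _ _ => normr_ge0 _) rM.
have /(rsum_nneg_cvg (M := M *+ 2))[|S2 H2] :
    forall p q, 0 <= `|r p q| + r p q.
- by move=> p q; rewrite -lerBlDr sub0r -normrN ler_norm.
- move=> N; rewrite mulr2n (le_trans _ (lerD (rM N) (rM N)))// -rsumD.
  by apply: ler_rsum => p q; rewrite lerD2l ler_norm.
exists (S2 - S1) => e e0; have e2 : 0 < e / 2 by rewrite divr_gt0.
have [N HN] := H1 _ e2; have [N' HN'] := H2 _ e2.
exists (maxn N N') => a b; rewrite !geq_max => /andP[Na Na'] /andP[Nb Nb'].
have := HN _ _ Na Nb; have := HN' _ _ Na' Nb'; rewrite rsumD.
set u := rsum _ _ _; set v := rsum r a b => h1 h2.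
have -> : S2 - S1 - v = (S2 - (u + v)) - (S1 - u).
  by lra.
by rewrite (le_lt_trans (ler_normB _ _))//; lra.
Qed.

Lemma l1_dsum_cvg h : l1 h -> exists S, dsum_cvg h S.
Proof.
move=> [M HM].
have [|a Ha] := @rsum_abs_cvg (fun p q => complex.Re (h p q)) M.
  by move=> N; rewrite (le_trans _ (HM N))//; apply: ler_rsum => p q; apply: Re_le_normc.
have [|b Hb] := @rsum_abs_cvg (fun p q => complex.Im (h p q)) M.
  by move=> N; rewrite (le_trans _ (HM N))//; apply: ler_rsum => p q; apply: Im_le_normc.
exists (a +i* b)%C => e e0; have e2 : 0 < e / 2 by rewrite divr_gt0.
have [N HN] := Ha _ e2; have [N' HN'] := Hb _ e2.
exists (maxn N N') => c d; rewrite !geq_max => /andP[Nc Nc'] /andP[Nd Nd'].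
rewrite (le_lt_trans (normc_le_ReIm _))//.
have reE : complex.Re (rsum h c d) = rsum (fun p q => complex.Re (h p q)) c d.
  by rewrite /rsum !raddf_sum; apply: eq_bigr => p _; rewrite raddf_sum.
have imE : complex.Im (rsum h c d) = rsum (fun p q => complex.Im (h p q)) c d.
  by rewrite /rsum !raddf_sum; apply: eq_bigr => p _; rewrite raddf_sum.
rewrite !raddfB /= reE imE.
by have := HN _ _ Nc Nd; have := HN' _ _ Nc' Nd'; lra.
Qed.

End DoubleSeries.

(** * Backward differences on the quadrant *)

Section BackwardDifferences.
Variable V : pzRingType.
Implicit Types h : nat -> nat -> V.

(** Extension by 0 outside the quadrant makes the shift act on [z]-weighted sums as exact
    multiplication by [z], without boundary terms. *)
Definition shift1 h p q := if p is p'.+1 then h p' q else 0.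
Definition bdiff1 h p q := h p q - shift1 h p q.
Definition bdiff2 h p q := h p q - (if q is q'.+1 then h p q' else 0).
Definition bdiff12 h := bdiff1 (bdiff2 h).

Lemma bdiff2_transpose h p q : bdiff2 h p q = bdiff1 (fun p q => h q p) q p.
Proof. by []. Qed.

Lemma bdiff12C h : bdiff12 h = bdiff2 (bdiff1 h).
Proof.
apply/funext => p; apply/funext => q; rewrite /bdiff12 /bdiff1 /bdiff2 /shift1.
case: p q => [|p] [|q]; rewrite ?subr0//.
by rewrite !opprB addrACA [RHS]addrACA [X in _ + X = _]addrC.
Qed.

(** Separating the two directions lets the decay be proved with differences in one variable only,
    the others being bounded trivially. *)
Lemma iter_bdiff12C J h : iter J bdiff12 h = iter J bdiff2 (iter J bdiff1 h).
Proof.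
have C n g : bdiff1 (iter n bdiff2 g) = iter n bdiff2 (bdiff1 g).
  by elim: n => //= n IH; rewrite -IH -bdiff12C.
elim: J => //= J ->; rewrite bdiff12C; congr bdiff2; rewrite C.
by congr (iter J bdiff2 _).
Qed.

Lemma bdiff1D h1 h2 :
  bdiff1 (fun p q => h1 p q + h2 p q) = (fun p q => bdiff1 h1 p q + bdiff1 h2 p q).
Proof.
apply/funext => -[|p]; apply/funext => q; rewrite /bdiff1 /= ?subr0//.
by rewrite opprD addrACA.
Qed.

Lemma bdiff2D h1 h2 :
  bdiff2 (fun p q => h1 p q + h2 p q) = (fun p q => bdiff2 h1 p q + bdiff2 h2 p q).
Proof.
apply/funext => p; apply/funext => -[|q]; rewrite /bdiff2 /= ?subr0//.
by rewrite opprD addrACA.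
Qed.

Lemma bdiff1M c h : bdiff1 (fun p q => c * h p q) = (fun p q => c * bdiff1 h p q).
Proof.
by apply/funext => -[|p]; apply/funext => q; rewrite /bdiff1 /= ?subr0// mulrBr.
Qed.

Lemma bdiff2M c h : bdiff2 (fun p q => c * h p q) = (fun p q => c * bdiff2 h p q).
Proof.
by apply/funext => p; apply/funext => -[|q]; rewrite /bdiff2 /= ?subr0// mulrBr.
Qed.

Lemma iter_bdiff12D J h1 h2 : iter J bdiff12 (fun p q => h1 p q + h2 p q) =
  (fun p q => iter J bdiff12 h1 p q + iter J bdiff12 h2 p q).
Proof. by elim: J => //= J ->; rewrite /bdiff12 bdiff2D bdiff1D. Qed.

Lemma iter_bdiff12M J c h : iter J bdiff12 (fun p q => c * h p q) =
  (fun p q => c * iter J bdiff12 h p q).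
Proof. by elim: J => //= J ->; rewrite /bdiff12 bdiff2M bdiff1M. Qed.

Lemma rsum_shift1 h a b : rsum (shift1 h) a.+1 b = rsum h a b.
Proof. by rewrite /rsum big_ord_recl /= big1 ?add0r. Qed.

Lemma rsum_transpose h a b : rsum (fun p q => h q p) a b = rsum h b a.
Proof. exact: exchange_big. Qed.

End BackwardDifferences.

(** * Regularized sums by repeated summation by parts *)

Section RegularizedSums.
Variable R : realType.
Implicit Types (h : nat -> nat -> R[i]) (z : R[i]).

Lemma dsum_cvg_shift1 h S : dsum_cvg h S -> dsum_cvg (shift1 h) S.
Proof.
move=> H e e0; have [N HN] := H _ e0; exists N.+1 => -[//|a] b Na Nb.
by rewrite rsum_shift1 HN// ltnW.
Qed.

Lemma dsum_cvg_transpose h S : dsum_cvg h S -> dsum_cvg (fun p q => h q p) S.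
Proof.
move=> H e e0; have [N HN] := H _ e0; exists N => a b Na Nb.
by rewrite rsum_transpose HN.
Qed.

Lemma l1_transpose h : l1 h -> l1 (fun p q => h q p).
Proof. by move=> [M HM]; exists M => N; rewrite (rsum_transpose (fun p q => normc (h p q))). Qed.

Lemma l1_shift1 h : l1 h -> l1 (shift1 h).
Proof.
move=> [M HM]; exists M => -[|N]; first by have := HM 0%N; rewrite /rsum !big_ord0.
rewrite (eq_rsum (h2 := shift1 (fun p q => normc (h p q)))); last first.
  by move=> [|p] q _ _; first exact: Normc.normc0.
rewrite rsum_shift1 (le_trans _ (HM N.+1))// ler_rsum_widen// => p q.
exact: normc_ge0.
Qed.

Lemma l1_bdiff1 h : l1 h -> l1 (bdiff1 h).
Proof.
move=> H; have := l1D H (l1M (-1) (l1_shift1 H)); apply: le_l1 => p q.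
by rewrite mulN1r.
Qed.

Lemma l1_bdiff2 h : l1 h -> l1 (bdiff2 h).
Proof.
move=> /l1_transpose/l1_bdiff1/l1_transpose; apply: le_l1 => p q.
by rewrite bdiff2_transpose.
Qed.

Definition twist z1 z2 h p q := z1 ^+ p * z2 ^+ q * h p q.

(** Reindexing the shifted part gives [S - z1 S]: this is one summation by parts. *)
Lemma twist_bdiff1_cvg z1 z2 h S : dsum_cvg (twist z1 z2 h) S ->
  dsum_cvg (twist z1 z2 (bdiff1 h)) ((1 - z1) * S).
Proof.
move=> H; have := dsum_cvgB H (dsum_cvgM z1 (dsum_cvg_shift1 H)).
rewrite -{1}[S]mul1r -mulrBl; apply: dsum_cvg_ext => -[|p] q.
  by rewrite /twist /bdiff1 /= mulr0 !subr0.
by rewrite /twist /bdiff1 /= mulrBr !mulrA exprS.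
Qed.

Lemma twist_bdiff2_cvg z1 z2 h S : dsum_cvg (twist z1 z2 h) S ->
  dsum_cvg (twist z1 z2 (bdiff2 h)) ((1 - z2) * S).
Proof.
move=> /dsum_cvg_transpose H.
have /twist_bdiff1_cvg/dsum_cvg_transpose :
    dsum_cvg (twist z2 z1 (fun p q => h q p)) S.
  by apply: dsum_cvg_ext H => p q; rewrite /twist [z1 ^+ _ * _]mulrC.
by apply: dsum_cvg_ext => p q; rewrite /twist [z1 ^+ _ * _]mulrC.
Qed.

Definition reg_sum_at z1 z2 h J S :=
  l1 (iter J (@bdiff12 _) h) /\
  dsum_cvg (twist z1 z2 (iter J (@bdiff12 _) h)) (((1 - z1) * (1 - z2)) ^+ J * S).

(* Summation by parts in both variables, performed J times, turns
   (1 - z1)^J (1 - z2)^J times the sum of the z1^p z2^q h p q into the sum of the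
   z1^p z2^q (bdiff12^J h) p q, which may converge although the former diverges. *)
Definition reg_sum z1 z2 h S := exists J, reg_sum_at z1 z2 h J S.

Lemma reg_sum_atS z1 z2 h J S : reg_sum_at z1 z2 h J S -> reg_sum_at z1 z2 h J.+1 S.
Proof.
move=> [L1 C]; split; first by apply/l1_bdiff1/l1_bdiff2.
have := twist_bdiff1_cvg (twist_bdiff2_cvg C); congr (dsum_cvg _ _).
by rewrite exprS !mulrA.
Qed.

Lemma reg_sum_at_leq z1 z2 h J J' S : (J <= J')%N ->
  reg_sum_at z1 z2 h J S -> reg_sum_at z1 z2 h J' S.
Proof.
move=> /subnK <- H; elim: (J' - J)%N => [//|n]; exact: reg_sum_atS.
Qed.

Lemma reg_sum_at_uniq z1 z2 h J S S' : z1 != 1 -> z2 != 1 ->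
  reg_sum_at z1 z2 h J S -> reg_sum_at z1 z2 h J S' -> S = S'.
Proof.
move=> z11 z21 [_ C] [_ C']; have := dsum_cvg_uniq C C'; apply: mulfI.
by rewrite expf_neq0// mulf_neq0// subr_eq0 eq_sym.
Qed.

(** Both orders are raised to their maximum, where the nonzero factor [((1 - z1)(1 - z2))^J]
    cancels. Thus values found with different orders, or by different methods, agree. *)
Lemma reg_sum_uniq z1 z2 h S S' : z1 != 1 -> z2 != 1 ->
  reg_sum z1 z2 h S -> reg_sum z1 z2 h S' -> S = S'.
Proof.
move=> z11 z21 [J H] [J' H'].
apply: (reg_sum_at_uniq z11 z21 (reg_sum_at_leq (leq_maxl J J') H)).
exact: reg_sum_at_leq (leq_maxr J J') H'.
Qed.

Lemma reg_sum_atD z1 z2 h1 h2 J S1 S2 :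
  reg_sum_at z1 z2 h1 J S1 -> reg_sum_at z1 z2 h2 J S2 ->
  reg_sum_at z1 z2 (fun p q => h1 p q + h2 p q) J (S1 + S2).
Proof.
move=> [L1 C1] [L2 C2]; rewrite /reg_sum_at iter_bdiff12D; split; first exact: l1D.
rewrite mulrDr; apply: dsum_cvg_ext (dsum_cvgD C1 C2) => p q.
by rewrite /twist mulrDr.
Qed.

Lemma reg_sum_atM z1 z2 c h J S : reg_sum_at z1 z2 h J S ->
  reg_sum_at z1 z2 (fun p q => c * h p q) J (c * S).
Proof.
move=> [L C]; rewrite /reg_sum_at iter_bdiff12M; split; first exact: l1M.
rewrite mulrCA; apply: dsum_cvg_ext (dsum_cvgM c C) => p q.
by rewrite /twist mulrCA.
Qed.

Lemma normc_twist z1 z2 h p q : normc z1 = 1 -> normc z2 = 1 ->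
  normc (twist z1 z2 h p q) = normc (h p q).
Proof. by move=> n1 n2; rewrite /twist !Normc.normcM !normcX n1 n2 !expr1n !mul1r. Qed.

Lemma reg_sum_at_ex z1 z2 h J : normc z1 = 1 -> normc z2 = 1 ->
  z1 != 1 -> z2 != 1 -> l1 (iter J (@bdiff12 _) h) ->
  exists S, reg_sum_at z1 z2 h J S.
Proof.
move=> n1 n2 z11 z21 L; have /l1_dsum_cvg[S HS] : l1 (twist z1 z2 (iter J (@bdiff12 _) h)).
  by apply: le_l1 L => p q; rewrite normc_twist.
exists ((((1 - z1) * (1 - z2)) ^+ J)^-1 * S); split=> //.
by rewrite mulVKf// expf_neq0// mulf_neq0// subr_eq0 eq_sym.
Qed.

Lemma reg_sum_at_le z1 z2 h J S M : normc z1 = 1 -> normc z2 = 1 ->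
  z1 != 1 -> z2 != 1 -> l1_bound (iter J (@bdiff12 _) h) M ->
  reg_sum_at z1 z2 h J S ->
  normc S <= (normc ((1 - z1) * (1 - z2)) ^+ J)^-1 * M.
Proof.
move=> n1 n2 z11 z21 HM [_ C].
have c0 : (1 - z1) * (1 - z2) != 0 by rewrite mulf_neq0// subr_eq0 eq_sym.
have n0 : 0 < normc ((1 - z1) * (1 - z2)).
  by rewrite lt0r normc_ge0 andbT; apply: contra_neq c0; apply: Normc.eq0_normc.
rewrite ler_pdivlMl ?exprn_gt0// -normcX -Normc.normcM.
apply: dsum_cvg_le C; apply: le_l1_bound HM => p q.
by rewrite normc_twist.
Qed.

End RegularizedSums.

(** * Differences of smooth functions *)

Section SmoothDifferences.
Variable R : realType.
Implicit Types (f : nat -> R -> R) (t u M : R).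

Definition fdiff (f : R -> R) (t : R) := f (t + 1) - f t.

Lemma is_derive_fdiff (f : R -> R) t d0 d1 : is_derive t 1 f d0 ->
  is_derive (t + 1) 1 f d1 -> is_derive t 1 (fdiff f) (d1 - d0).
Proof.
move=> D0 D1; have Ds : is_derive t 1 (fun t : R => t + 1) (1 + 0).
  exact: is_deriveD (is_derive_id _ _) (is_derive_cst _ _ _).
have := is_deriveB (@is_derive1_comp _ f (fun t => t + 1) _ _ _ D1 Ds) D0.
by rewrite addr0 mulr1.
Qed.

Lemma ler_mvt (f df : R -> R) u v M : u <= v ->
  (forall t, u <= t <= v -> is_derive t 1 f (df t)) ->
  (forall t, u <= t <= v -> `|df t| <= M) -> `|f v - f u| <= M * (v - u).
Proof.
move=> uv D b.
have Dd : forall t, t \in `]u, v[ -> is_derive t 1 f (df t).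
  by move=> t; rewrite in_itv /= => /andP[/ltW ut /ltW tv]; apply: D; rewrite ut.
have Cf : {within `[u, v], continuous f}.
  apply: derivable_within_continuous => t; rewrite in_itv /= => /D ?.
  exact: ex_derive.
have [c cI ->] := MVT_segment uv Dd Cf.
rewrite normrM (ger0_norm (x := v - u)) ?subr_ge0// ler_wpM2r ?subr_ge0//.
by apply: b; move: cI; rewrite in_itv.
Qed.

(** Induction over whole chains of derivatives: the functions [fdiff (f k)] form a chain again, and
    one mean value step on [[t, t + 1]] trades [f J.+1] for [fdiff (f J)] while the interval
    shortens by 1. *)
Lemma ler_iter_fdiff f J u M : 0 <= u ->
  (forall k t, 0 <= t -> is_derive t 1 (f k) (f k.+1 t)) ->
  (forall t, u <= t <= u + J%:R -> `|f J t| <= M) ->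
  `|iter J fdiff (f 0%N) u| <= M.
Proof.
move=> u0; elim: J f => [|J IH] f D b; first by apply: b; rewrite addr0 lexx.
rewrite iterSr; apply: (IH (fun k => fdiff (f k))) => [k t t0|t /andP[ut tu]].
  by apply: is_derive_fdiff; apply: D => //; rewrite addr_ge0.
have := @ler_mvt (f J) (f J.+1) t (t + 1) M.
rewrite /fdiff addrAC subrr add0r mulr1; apply; first by rewrite lerDl.
  by move=> v /andP[tv _]; apply: D; apply: le_trans tv; apply: le_trans ut.
move=> v /andP[tv vt]; apply: b; rewrite (le_trans ut tv)/=.
by rewrite -[J.+1]addn1 natrD addrA (le_trans vt)// lerD2r.
Qed.

(** From [J] on, the differences no longer meet the zeros inserted at negative indices, and become
    forward differences based at [n]. *)
Lemma iter_bdiff1_fdiff (h : nat -> nat -> R) (F : R -> R) q J n :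
  (forall p, h p q = F p%:R) ->
  iter J (@bdiff1 R) h (J + n)%N q = iter J fdiff F n%:R.
Proof.
move=> hF; elim: J n => [|J IH] n; first exact: hF.
rewrite !iterS {1}/bdiff1 addSn /= IH -addnS IH /fdiff.
by rewrite -[n.+1]addn1 natrD.
Qed.

(** The trivial bound, one factor 2 per difference. It serves where the inserted zeros destroy
    smoothness, and for the differences whose gain is given up. *)
Lemma ler_iter_bdiff1 (h : nat -> nat -> R) J p q M :
  (forall p', (p' <= p)%N -> `|h p' q| <= M) ->
  `|iter J (@bdiff1 R) h p q| <= 2 ^+ J * M.
Proof.
elim: J p => [|J IH] p b; first by rewrite mul1r b.
have M0 : 0 <= M by rewrite (le_trans _ (b p (leqnn _))).
rewrite iterS {1}/bdiff1 exprS -mulrA mulr_natl mulr2n.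
rewrite (le_trans (ler_normB _ _))// lerD ?IH//.
case: p b => [|p] b /=; first by rewrite normr0 mulr_ge0// exprn_ge0.
by apply: IH => p' pp; apply: b; apply: ltnW.
Qed.

End SmoothDifferences.

(** * Derivatives, along a line, of functions of a logarithm *)

Section LogarithmicSymbols.
Variable R : realType.
Implicit Types (G : nat -> R -> R) (x y : R).

(* The term (c, k, i, j) stands for c * G_k (ln x + ln y) / (x^i y^j) where G_k is the
   k-th derivative of G; along a line (x, y) = (x0 + a t, y0 + b t) the
   derivative of such a term is a sum of four terms with i + j increased by 1. *)
Definition symbol := seq (R * nat * nat * nat).

Definition term_eval G x y (t : R * nat * nat * nat) : R :=
  let: (c, k, i, j) := t in c * G k (ln x + ln y) * (x^-1 ^+ i * y^-1 ^+ j).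

Definition symbol_eval G (s : symbol) x y := \sum_(t <- s) term_eval G x y t.

Definition term_deriv (a b : R) (t : R * nat * nat * nat) : symbol :=
  let: (c, k, i, j) := t in
  [:: (c * a, k.+1, i.+1, j); (c * b, k.+1, i, j.+1);
      (- (c * a * i%:R), k, i.+1, j); (- (c * b * j%:R), k, i, j.+1)].

Definition symbol_deriv a b (s : symbol) := flatten (map (term_deriv a b) s).

Lemma is_derive_line (x0 a t : R) : is_derive t 1 (fun t => x0 + a * t) a.
Proof.
have D : is_derive t 1 (cst x0 + a *: (id : R -> R)) (0 + a *: 1).
  exact: is_deriveD (is_derive_cst _ _ _) (is_deriveZ a (is_derive_id _ _)).
by move: D; rewrite add0r [a *: 1]mulr1.
Qed.

Lemma is_derive_ln_line (x0 a t : R) : 0 < x0 + a * t ->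
  is_derive t 1 (fun t => ln (x0 + a * t)) ((x0 + a * t)^-1 * a).
Proof.
move=> p; apply: (@is_derive1_comp _ (@ln R) (fun t => x0 + a * t)).
  exact: is_derive1_ln.
exact: is_derive_line.
Qed.

Lemma is_derive_invX_line (x0 a t : R) i : 0 < x0 + a * t ->
  is_derive t 1 (fun t => (x0 + a * t)^-1 ^+ i) (- (a * i%:R) * (x0 + a * t)^-1 ^+ i.+1).
Proof.
move=> p; have n0 : x0 + a * t != 0 by rewrite gt_eqF.
have D : is_derive t 1 (fun t => (x0 + a * t)^-1) (- (x0 + a * t) ^- 2 *: a).
  exact: (@is_deriveV _ (fun t => x0 + a * t) t a 1 n0 (is_derive_line _ _ _)).
have := @is_deriveX _ _ _ i t 1 _ D.
have -> : (fun t => (x0 + a * t)^-1) ^+ i = (fun t => (x0 + a * t)^-1 ^+ i).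
  by apply/funext => u; rewrite exprfctE.
move=> /is_derive_eq; apply; rewrite /GRing.scale /= -exprVn.
case: i => [|i]; first by rewrite !mul0r mulr0 oppr0 mul0r.
by rewrite /= [_ ^+ i.+2]exprS [_ ^+ i.+1]exprS expr2; ring.
Qed.

Lemma is_derive_term G (x0 a y0 b t : R) s :
  (forall k (l : R), is_derive l 1 (G k) (G k.+1 l)) ->
  0 < x0 + a * t -> 0 < y0 + b * t ->
  is_derive t 1 (fun t => term_eval G (x0 + a * t) (y0 + b * t) s)
    (symbol_eval G (term_deriv a b s) (x0 + a * t) (y0 + b * t)).
Proof.
case: s => [[[c k] i] j] DG x_gt0 y_gt0.
pose x t := x0 + a * t; pose y t := y0 + b * t.
pose L t := ln (x t) + ln (y t).
have DL : is_derive t 1 L ((x t)^-1 * a + (y t)^-1 * b).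
  exact: is_deriveD (is_derive_ln_line x_gt0) (is_derive_ln_line y_gt0).
have DGL : is_derive t 1 (G k \o L) (G k.+1 (L t) * ((x t)^-1 * a + (y t)^-1 * b)).
  exact: is_derive1_comp.
have DX := is_deriveM (is_derive_invX_line i x_gt0) (is_derive_invX_line j y_gt0).
have := is_deriveM (is_deriveZ c DGL) DX.
set F := (X in is_derive _ _ X _); move=> D.
have -> : (fun t => term_eval G (x0 + a * t) (y0 + b * t) (c, k, i, j)) = F by [].
apply: is_derive_eq D _.
rewrite /symbol_eval /= !big_cons big_nil /= -/(x t) -/(y t) -/(L t) addr0.
rewrite -[LHS]/(c * G k (L t) *
    ((x t)^-1 ^+ i * (- (b * j%:R) * (y t)^-1 ^+ j.+1) +
     (y t)^-1 ^+ j * (- (a * i%:R) * (x t)^-1 ^+ i.+1)) +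
  ((x t)^-1 ^+ i * (y t)^-1 ^+ j) *
     (c * (G k.+1 (L t) * ((x t)^-1 * a + (y t)^-1 * b)))).
rewrite !exprS; ring.
Qed.

Lemma is_derive_symbol G (x0 a y0 b t : R) (s : symbol) :
  (forall k (l : R), is_derive l 1 (G k) (G k.+1 l)) ->
  0 < x0 + a * t -> 0 < y0 + b * t ->
  is_derive t 1 (fun t => symbol_eval G s (x0 + a * t) (y0 + b * t))
    (symbol_eval G (symbol_deriv a b s) (x0 + a * t) (y0 + b * t)).
Proof.
move=> DG x_gt0 y_gt0; elim: s => [|s l IH].
  rewrite /symbol_deriv /symbol_eval /= big_nil.
  have -> : (fun t : R => \sum_(s <- [::]) term_eval G (x0 + a * t) (y0 + b * t) s) = cst 0.
    by apply/funext => u; rewrite big_nil.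
  exact: is_derive_cst.
have -> : (fun t => symbol_eval G (s :: l) (x0 + a * t) (y0 + b * t)) =
    (fun t => term_eval G (x0 + a * t) (y0 + b * t) s) +
    (fun t => symbol_eval G l (x0 + a * t) (y0 + b * t)).
  by apply/funext => u; rewrite /symbol_eval big_cons.
have -> : symbol_eval G (symbol_deriv a b (s :: l)) (x0 + a * t) (y0 + b * t) =
    symbol_eval G (term_deriv a b s) (x0 + a * t) (y0 + b * t) +
    symbol_eval G (symbol_deriv a b l) (x0 + a * t) (y0 + b * t).
  by rewrite /symbol_eval /symbol_deriv /= big_cat.
exact: is_deriveD (is_derive_term _ _ _ _) IH.
Qed.

(** Every differentiation raises [i + j] by exactly 1, and this is the source of the decay: up to
    the growth of [G], a symbol of order [J] has size [m^-J] where both linear forms are at least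
    [m]. The bound on [k] limits the derivatives of [G] to be estimated. *)
Definition symbol_order (J : nat) (s : symbol) :=
  all (fun t => let: (c, k, i, j) := t in (i + j == J)%N && (k <= J)%N) s.

Lemma symbol_order_deriv a b J s :
  symbol_order J s -> symbol_order J.+1 (symbol_deriv a b s).
Proof.
elim: s => [//|[[[c k] i] j] s IH] /= /andP[/andP[ij kJ] {}/IH].
rewrite /symbol_order /symbol_deriv /= => ->.
by rewrite !addSn !addnS !eqSS !ij !ltnS kJ !leqW.
Qed.

Lemma ler_symbol_eval G B K J (s : symbol) x y m :
  (forall k l, (k <= J)%N -> `|G k l| <= B * expR `|l| ^+ K) ->
  0 < m -> m <= x -> m <= y -> symbol_order J s ->
  `|symbol_eval G s x y| <=
    (\sum_(t <- s) `|t.1.1.1|) * (B * expR `|ln x + ln y| ^+ K * m^-1 ^+ J).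
Proof.
move=> HG m0 mx my; elim: s => [|[[[c k] i] j] s IH].
  by rewrite /symbol_eval !big_nil normr0 mul0r.
rewrite /= => /andP[/andP[/eqP ij kJ] /IH {}IH].
rewrite /symbol_eval !big_cons mulrDl (le_trans (ler_normD _ _))// lerD// {IH}.
rewrite /= normrM normrM -!mulrA ler_wpM2l// mulrA ler_pM ?HG//.
have x0 := lt_le_trans m0 mx; have y0 := lt_le_trans m0 my.
rewrite normrM -ij exprD !normrX !normfV (gtr0_norm x0) (gtr0_norm y0).
have HX u n : m <= u -> u^-1 ^+ n <= m^-1 ^+ n.
  move=> mu; have u0 := lt_le_trans m0 mu.
  by apply: lerXn2r; rewrite ?nnegrE ?invr_ge0 ?lef_pV2 ?posrE// ltW.
by rewrite ler_pM ?HX// exprn_ge0// invr_ge0 ltW.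
Qed.

End LogarithmicSymbols.

(** * Decay of differences in one variable *)

Section Decay.
Variable R : realType.
Implicit Types (G : nat -> R -> R) (x y N : R).

(** [exp |ln (x y)|] is either [x y] or its inverse; the two terms bound these two cases, the second
    using [N >= 1]. *)
Lemma ler_expR_norm_ln (rho sigma N x y : R) : 0 < rho -> 1 <= N ->
  rho <= x -> x <= sigma * N -> rho <= y -> y <= sigma * N ->
  expR `|ln x + ln y| <= (sigma ^+ 2 + rho^-1 ^+ 2) * N ^+ 2.
Proof.
move=> r0 N1 rx xs ry ys; have x0 := lt_le_trans r0 rx; have y0 := lt_le_trans r0 ry.
rewrite -lnM ?posrE//; have xy0 : 0 < x * y by rewrite mulr_gt0.
have N2 : 1 <= N ^+ 2 by rewrite exprn_ege1.
have le1 : x * y <= sigma ^+ 2 * N ^+ 2.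
  by rewrite -exprMn expr2; apply: ler_pM => //; apply: ltW.
have le2 : (x * y)^-1 <= rho^-1 ^+ 2 * N ^+ 2.
  rewrite -[leLHS]mulr1; apply: ler_pM => //; first by rewrite invr_ge0 ltW.
  by rewrite invfM expr2; apply: ler_pM; rewrite ?invr_ge0 ?lef_pV2 ?posrE//; exact: ltW.
have s0 : 0 <= sigma ^+ 2 * N ^+ 2 by rewrite mulr_ge0// sqr_ge0.
have r20 : 0 <= rho^-1 ^+ 2 * N ^+ 2 by rewrite mulr_ge0// sqr_ge0.
rewrite mulrDl; have [l0|l0] := lerP 0 (ln (x * y)).
  by rewrite (ger0_norm l0) lnK ?posrE//; lra.
by rewrite (ltr0_norm l0) expRN lnK ?posrE//; lra.
Qed.

(** Written so that for fixed [q] it is literally a line in [p], starting at [x0 + c q]. *)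
Definition lin_form (x0 a c : R) (p q : nat) : R := x0 + c * q%:R + a * p%:R.

Definition log_grid x0 a c y0 b d G p q : R :=
  G 0%N (ln (lin_form x0 a c p q) + ln (lin_form y0 b d p q)).

Section OneDirection.
Variables (rho sigma x0 a c y0 b d : R) (J K : nat).
Hypotheses (rho_gt0 : 0 < rho)
  (x0b : rho <= x0 <= sigma) (ab : rho <= a <= sigma) (cb : rho <= c <= sigma)
  (y0b : rho <= y0 <= sigma) (bb : rho <= b <= sigma) (db : rho <= d <= sigma).

Let sigma_gt0 : 0 < sigma.
Proof. by case/andP: ab => ra /(le_trans ra); apply: lt_le_trans. Qed.

Let line_bound (u v w t s q : R) : rho <= u <= sigma -> rho <= v <= sigma ->
  rho <= w <= sigma -> 0 <= q -> 0 <= t -> t <= s ->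
  [/\ rho * (1 + q + t) <= u + w * q + v * t & u + w * q + v * t <= sigma * (1 + q + s)].
Proof.
move=> /andP[u1 u2] /andP[v1 v2] /andP[w1 w2] q0 t0 ts.
have := ler_wpM2r q0 w1; have := ler_wpM2r q0 w2.
have := ler_wpM2r t0 v1; have := ler_wpM2r t0 v2.
have := ler_wpM2l (ltW sigma_gt0) ts.
by move=> *; split; lra.
Qed.

Let Q := sigma ^+ 2 + rho^-1 ^+ 2.

Let Q_ge0 : 0 <= Q. Proof. by rewrite addr_ge0// sqr_ge0. Qed.

Let grid_bound G B p q : (forall l, `|G 0%N l| <= B * expR `|l| ^+ K) -> 0 <= B ->
  `|log_grid x0 a c y0 b d G p q| <= B * (Q * (p + q + 1)%:R ^+ 2) ^+ K.
Proof.
move=> HG B0; rewrite (le_trans (HG _))// ler_wpM2l// lerXn2r ?nnegrE ?expR_ge0//.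
  by rewrite mulr_ge0// sqr_ge0.
have [h1 h2] := @line_bound x0 a c p%:R p%:R q%:R x0b ab cb (ler0n _ _) (ler0n _ _) (lexx _).
have [h3 h4] := @line_bound y0 b d p%:R p%:R q%:R y0b bb db (ler0n _ _) (ler0n _ _) (lexx _).
have e : 1 + q%:R + p%:R = (p + q + 1)%:R :> R.
  by rewrite !natrD; ring.
rewrite e in h1 h2 h3 h4.
have N1 : 1 <= (p + q + 1)%:R :> R by rewrite ler1n addn1.
have hr : rho <= rho * (p + q + 1)%:R by rewrite ler_peMr// ltW.
apply: ler_expR_norm_ln => //; exact: le_trans hr _.
Qed.

(** Away from the boundary: the coefficients of the symbol of the [J]-th derivative, the growth
    [Q ^+ K] of [G], and the bound [x, y >= rho N / (J + 1)]. *)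
Let C1 := (\sum_(t <- iter J (symbol_deriv a b) [:: (1, 0%N, 0%N, 0%N)]) `|t.1.1.1|) *
  Q ^+ K * (J.+1%:R / rho) ^+ J.
(** Near the corner: [2 ^+ J] comes from the triangle inequality, and [(2 J) ^+ J] offsets the
    division by [N ^+ J], as [N <= 2 J] there. *)
Let C2 := 2 ^+ J * Q ^+ K * (2 * J)%:R ^+ J.

Let interior G B n q : (forall k (l : R), is_derive l 1 (G k) (G k.+1 l)) ->
  (forall k l, (k <= J)%N -> `|G k l| <= B * expR `|l| ^+ K) -> 0 <= B ->
  `|iter J (@bdiff1 R) (log_grid x0 a c y0 b d G) (J + n)%N q| <=
    C1 * B * ((J + n + q + 1)%:R ^+ (2 * K) / (J + n + q + 1)%:R ^+ J).
Proof.
move=> DG HG B0; set N := (_ + 1)%:R.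
pose x t := x0 + c * q%:R + a * t; pose y t := y0 + d * q%:R + b * t.
pose f k t := symbol_eval G (iter k (symbol_deriv a b) [:: (1, 0%N, 0%N, 0%N)]) (x t) (y t).
rewrite (@iter_bdiff1_fdiff _ _ (f 0%N)); last first.
  by move=> p; rewrite /f /symbol_eval /= big_seq1 /= mul1r !expr0 !mulr1.
have N0 : 0 < N by rewrite ltr0n addn1.
have NE : N = 1 + q%:R + (n%:R + J%:R).
  by rewrite /N !natrD; ring.
have J1 : 0 < J.+1%:R :> R by rewrite ltr0n.
apply: ler_iter_fdiff; first exact: ler0n.
  move=> k t t0; apply: is_derive_symbol => //.
    have [h _] := @line_bound x0 a c t t q%:R x0b ab cb (ler0n _ _) t0 (lexx _).
    by apply: lt_le_trans h; rewrite mulr_gt0// ltr_wpDr// ltr_wpDr.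
  have [h _] := @line_bound y0 b d t t q%:R y0b bb db (ler0n _ _) t0 (lexx _).
  by apply: lt_le_trans h; rewrite mulr_gt0// ltr_wpDr// ltr_wpDr.
move=> t /andP[nt tn]; have t0 : 0 <= t by apply: le_trans nt; apply: ler0n.
have [h1 h2] := @line_bound x0 a c t (n%:R + J%:R) q%:R x0b ab cb (ler0n _ _) t0 tn.
have [h3 h4] := @line_bound y0 b d t (n%:R + J%:R) q%:R y0b bb db (ler0n _ _) t0 tn.
rewrite -!NE -/(x t) -/(y t) in h1 h2 h3 h4.
have one : 1 <= 1 + q%:R + t :> R by rewrite -addrA lerDl addr_ge0.
have hr : rho <= rho * (1 + q%:R + t) by rewrite ler_peMr// ltW.
(* [N = 1 + q + n + J] is at most [(J + 1)(1 + q + t)], because [t >= n] and [1 + q + t >= 1]: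
   moving within a window of width [J] costs only a constant factor. *)
pose m := rho * (N / J.+1%:R).
have m0 : 0 < m by rewrite mulr_gt0// divr_gt0.
have hm : m <= rho * (1 + q%:R + t).
  rewrite /m (ler_wpM2l (ltW rho_gt0))// ler_pdivrMr// NE -[J.+1]addn1 natrD mulrDr mulr1.
  have := ler_wpM2r (ler0n R J) one; lra.
have sJ : symbol_order J (iter J (symbol_deriv a b) [:: (1, 0%N, 0%N, 0%N)]).
  by elim: (J) => //= j; apply: symbol_order_deriv.
rewrite (le_trans (ler_symbol_eval HG m0 (le_trans hm h1) (le_trans hm h3) sJ))//.
rewrite /C1 -!mulrA ler_wpM2l ?sumr_ge0//.
have eE : expR `|ln (x t) + ln (y t)| ^+ K <= Q ^+ K * N ^+ (2 * K).
  rewrite exprM -exprMn lerXn2r ?nnegrE ?expR_ge0//.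
    by rewrite mulr_ge0// sqr_ge0.
  apply: ler_expR_norm_ln => //; first by rewrite ler1n addn1.
    exact: le_trans h1.
  exact: le_trans h3.
have -> : m^-1 ^+ J = (J.+1%:R / rho) ^+ J / N ^+ J.
  by rewrite -exprVn -exprMn; congr (_ ^+ J); rewrite /m !invfM invrK; ring.
have -> : Q ^+ K * ((J.+1%:R / rho) ^+ J * (B * (N ^+ (2 * K) / N ^+ J))) =
  B * ((Q ^+ K * N ^+ (2 * K)) * ((J.+1%:R / rho) ^+ J / N ^+ J)) by ring.
rewrite ler_wpM2l// ler_wpM2r// divr_ge0// exprn_ge0 ?divr_ge0 ?ler0n// ltW//.
Qed.

Let corner G B p q : 
  (forall k l, (k <= J)%N -> `|G k l| <= B * expR `|l| ^+ K) -> 0 <= B ->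
  (p < J)%N -> (q <= p)%N ->
  `|iter J (@bdiff1 R) (log_grid x0 a c y0 b d G) p q| <=
    C2 * B * ((p + q + 1)%:R ^+ (2 * K) / (p + q + 1)%:R ^+ J).
Proof.
move=> HG B0 pJ qp; set N := (_ + 1)%:R; have N0 : 0 < N by rewrite ltr0n addn1.
have Qp n : 0 <= Q * n%:R ^+ 2 by rewrite mulr_ge0// sqr_ge0.
have /ler_iter_bdiff1/le_trans : forall p', (p' <= p)%N ->
    `|log_grid x0 a c y0 b d G p' q| <= B * (Q * N ^+ 2) ^+ K.
  move=> p' pp; rewrite (le_trans (@grid_bound _ B _ _ (HG 0%N ^~ isT) B0))//.
  have pN : (p' + q + 1)%:R <= N by rewrite ler_nat !leq_add2r.
  have pN2 : (p' + q + 1)%:R ^+ 2 <= N ^+ 2 by exact: lerXn2r (ler0n _ _) (ltW N0) pN.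
  exact: ler_wpM2l B0 _ _ (lerXn2r K (Qp _) (Qp _) (ler_wpM2l Q_ge0 pN2)).
apply; rewrite /C2 exprMn -exprM.
have -> : 2 ^+ J * Q ^+ K * (2 * J)%:R ^+ J * B * (N ^+ (2 * K) / N ^+ J) =
  2 ^+ J * (B * (Q ^+ K * N ^+ (2 * K))) * ((2 * J)%:R ^+ J / N ^+ J) by ring.
apply: ler_peMr.
  by rewrite !mulr_ge0// exprn_ge0// ltW.
have N2J : N <= (2 * J)%:R.
  rewrite ler_nat; clear -pJ qp; lia.
rewrite ler_pdivlMr ?exprn_gt0// mul1r.
exact: lerXn2r (ltW N0) (ler0n _ _) N2J.
Qed.

(** The restriction [q <= p] leaves only finitely many points with [p < J]. The constant is chosen
    before [G] and [B], so that the estimate is linear in the size of [G]. *)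
Lemma ler_iter_bdiff1_log_grid : exists2 C, 0 <= C & forall G B,
  (forall k (l : R), is_derive l 1 (G k) (G k.+1 l)) ->
  (forall k l, (k <= J)%N -> `|G k l| <= B * expR `|l| ^+ K) -> 0 <= B ->
  forall p q, (q <= p)%N ->
  `|iter J (@bdiff1 R) (log_grid x0 a c y0 b d G) p q| <=
    C * B * ((p + q + 1)%:R ^+ (2 * K) / (p + q + 1)%:R ^+ J).
Proof.
have C10 : 0 <= C1.
  by rewrite !mulr_ge0 ?sumr_ge0 ?exprn_ge0// divr_ge0// ltW.
have C20 : 0 <= C2 by rewrite !mulr_ge0 ?exprn_ge0.
exists (C1 + C2) => [|G B DG HG B0 p q qp]; first exact: addr_ge0.
have N0 : 0 <= B * ((p + q + 1)%:R ^+ (2 * K) / (p + q + 1)%:R ^+ J).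
  by rewrite mulr_ge0// divr_ge0// exprn_ge0.
rewrite -mulrA mulrDl; have [Jp|pJ] := leqP J p.
  rewrite -(subnKC Jp) (le_trans (interior _ _ DG HG B0))// subnKC// -mulrA.
  by rewrite lerDl mulr_ge0.
rewrite (le_trans (corner HG B0 pJ qp))// -mulrA lerDr.
by rewrite mulr_ge0.
Qed.

End OneDirection.

End Decay.

(** * Convergence of power sums *)

Section PowerSums.
Variable R : realType.

Lemma ler_sum_power (sigma : R) : 1 < sigma ->
  exists M, forall N, \sum_(p < N) expR (- sigma * ln p.+1%:R) <= M.
Proof.
move=> s1; pose a := sigma - 1; have a0 : 0 < a by rewrite subr_gt0.
pose u (n : nat) : R := expR (- a * ln n.+1%:R).
(* Comparison of [(n + 2)^-sigma] with the telescoping differences of [(n + 1)^-a], where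
   [a = sigma - 1]: the ratio of [u n] to [u n.+1] is bounded below by [exp x >= 1 + x], and the
   logarithm of [(n + 2) / (n + 1)] by [1 / (n + 2)]. *)
have step n : expR (- sigma * ln n.+2%:R) <= a^-1 * (u n - u n.+1).
  rewrite ler_pdivlMl//.
  have n1 : 0 < n.+1%:R :> R by rewrite ltr0n.
  have n2 : 0 < n.+2%:R :> R by rewrite ltr0n.
  have -> : u n = u n.+1 * expR (a * (ln n.+2%:R - ln n.+1%:R)).
    by rewrite /u -expRD; congr expR; ring.
  have -> : expR (- sigma * ln n.+2%:R) = u n.+1 * n.+2%:R^-1.
    rewrite -{2}[n.+2%:R]lnK ?posrE// -expRN /u -expRD; congr expR.
    by rewrite /a; ring.
  have l1 : n.+2%:R^-1 <= ln n.+2%:R - ln n.+1%:R :> R.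
    have : ln (1 + - n.+2%:R^-1) <= - n.+2%:R^-1 :> R.
      by apply: le_ln1Dx; rewrite ltrN2 invf_lt1// ltr1n.
    have -> : 1 - n.+2%:R^-1 = n.+1%:R / n.+2%:R :> R.
      by rewrite -[n.+1%:R](addrK 1) natr1 mulrBl mul1r divff ?lt0r_neq0.
    by rewrite ln_div ?posrE// => h; rewrite -lerN2 opprB.
  have := ler_wpM2l (ltW a0) l1; have := expR_ge1Dx (a * (ln n.+2%:R - ln n.+1%:R)).
  move=> h1 h2; have -> : forall x, u n.+1 * x - u n.+1 = u n.+1 * (x - 1) by move=> x; ring.
  rewrite mulrCA; apply: ler_wpM2l; first exact: expR_ge0.
  by rewrite lerBrDl (le_trans _ h1)// lerD2l.
exists (1 + a^-1) => -[|N]; first by rewrite big_ord0 addr_ge0// invr_ge0 ltW.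
rewrite big_ord_recl /= ln1 mulr0 expR0 lerD2l.
apply: (@le_trans _ _ (a^-1 * (u 0%N - u N))).
  elim: N => [|N IH]; first by rewrite big_ord0 subrr mulr0.
  rewrite big_ord_recr /= (le_trans (lerD IH (step N)))// -mulrDr.
  by rewrite addrA subrK.
rewrite /u ln1 mulr0 expR0; apply: ler_piMr; first by rewrite invr_ge0 ltW.
by rewrite lerBlDr lerDl expR_ge0.
Qed.

Lemma rsum_mul (V : comPzRingType) (u v : nat -> V) a b :
  rsum (fun p q => u p * v q) a b = (\sum_(p < a) u p) * (\sum_(q < b) v q).
Proof. by rewrite /rsum mulr_suml; apply: eq_bigr => p _; rewrite mulr_sumr. Qed.

(* (p + q + 1)^2 >= (p + 1)(q + 1) separates the variables *)
Lemma l1_bound_power (sigma : R) : 2 < sigma -> exists2 M, 0 <= M &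
  forall (h : nat -> nat -> R[i]) C, 0 <= C ->
  (forall p q, normc (h p q) <= C * expR (- sigma * ln (p + q + 1)%:R)) ->
  l1_bound h (C * M).
Proof.
move=> s2; have [|M HM] := @ler_sum_power (sigma / 2); first by rewrite ltr_pdivlMr ?mul1r.
exists (M * M) => [|h C C0 hC N]; first exact: sqr_ge0.
pose u (p : nat) := expR (- (sigma / 2) * ln p.+1%:R).
apply: (@le_trans _ _ (rsum (fun p q => C * (u p * u q)) N N)).
  apply: ler_rsum => p q; rewrite (le_trans (hC p q))// ler_wpM2l//.
  rewrite /u -expRD ler_expR -mulrDr -lnM ?posrE ?ltr0n// !mulNr lerN2.
  have p0 : 0 < (p + q + 1)%:R :> R by rewrite ltr0n addn1.
  have -> : sigma * ln (p + q + 1)%:R = sigma / 2 * ln ((p + q + 1)%:R * (p + q + 1)%:R).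
    by rewrite lnM ?posrE//; field.
  apply: ler_wpM2l; first by rewrite divr_ge0//; lra.
  rewrite ler_ln ?posrE -?natrM ?ltr0n ?ler_nat//; nia.
rewrite rsumM rsum_mul ler_wpM2l// ler_pM// ?HM// sumr_ge0// => p _; exact: expR_ge0.
Qed.

End PowerSums.

(** * Decay of mixed differences, with complex values *)

Lemma morph_iter_bdiff12 (V W : pzRingType) (f : V -> W) J h p q :
  {morph f : x y / x - y} ->
  f (iter J (@bdiff12 V) h p q) = iter J (@bdiff12 W) (fun p q => f (h p q)) p q.
Proof.
move=> fB; have f0 : f 0 = 0 by rewrite -(subrr 0) fB subrr.
elim: J p q => //= J IH p q; rewrite /bdiff12 /bdiff1 /bdiff2 /shift1 fB.
by case: p q => [|p] [|q]; rewrite /= ?fB ?f0 -?IH.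
Qed.

Lemma iter_bdiff12_transpose (V : pzRingType) J (h : nat -> nat -> V) p q :
  iter J (@bdiff12 V) (fun p q => h q p) p q = iter J (@bdiff12 V) h q p.
Proof.
elim: J p q => // J IH p q; rewrite !iterS.
have -> : iter J (@bdiff12 V) (fun p q => h q p) = (fun p q => iter J (@bdiff12 V) h q p).
  by apply/funext => p'; apply/funext => q'; rewrite IH.
by rewrite -[RHS]/(bdiff12 (iter J (@bdiff12 V) h) q p) [in RHS]bdiff12C.
Qed.

Lemma iter_bdiff2_transpose (V : pzRingType) J (h : nat -> nat -> V) p q :
  iter J (@bdiff2 V) h p q = iter J (@bdiff1 V) (fun p q => h q p) q p.
Proof.
elim: J p q => // J IH p q; rewrite !iterS /bdiff2 /bdiff1 /shift1.
by case: q => [|q]; rewrite !IH.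
Qed.

Section ComplexDecay.
Variable R : realType.

(** Functions of a real variable are differentiated componentwise, since the mean value theorem is
    applied to real functions. *)
Definition cderive (f : R -> R[i]) (x : R) (d : R[i]) :=
  is_derive x 1 (fun t => complex.Re (f t)) (complex.Re d) /\
  is_derive x 1 (fun t => complex.Im (f t)) (complex.Im d).

Definition clog_grid (x0 a c y0 b d : R) (F : nat -> R -> R[i]) p q : R[i] :=
  F 0%N (ln (lin_form x0 a c p q) + ln (lin_form y0 b d p q)).

Lemma ler_bdiff12_log_grid (rho sigma x0 a c y0 b d : R) (J K : nat) : 0 < rho ->
  rho <= x0 <= sigma -> rho <= a <= sigma -> rho <= c <= sigma ->
  rho <= y0 <= sigma -> rho <= b <= sigma -> rho <= d <= sigma ->
  exists2 C, 0 <= C & forall (G : nat -> R -> R) B,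
  (forall k (l : R), is_derive l 1 (G k) (G k.+1 l)) ->
  (forall k l, (k <= J)%N -> `|G k l| <= B * expR `|l| ^+ K) -> 0 <= B ->
  forall p q,
  `|iter J (@bdiff12 R) (log_grid x0 a c y0 b d G) p q| <=
    C * B * ((p + q + 1)%:R ^+ (2 * K) / (p + q + 1)%:R ^+ J).
Proof.
move=> r0 X0 A C Y0 B D.
(* For [q <= p] the decay comes from differences in [p]. Those in [q] cost [2 ^+ J] and move [q]
   down to some [q'], where [p + q' + 1] is still at least half of [p + q + 1]; whence the second
   [2 ^+ J]. *)
have half C0 (h : nat -> nat -> R) p q : 0 <= C0 -> (q <= p)%N ->
   (forall p q, (q <= p)%N -> `|iter J (@bdiff1 R) h p q| <=
      C0 * ((p + q + 1)%:R ^+ (2 * K) / (p + q + 1)%:R ^+ J)) ->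
   `|iter J (@bdiff12 R) h p q| <=
      2 ^+ J * 2 ^+ J * C0 * ((p + q + 1)%:R ^+ (2 * K) / (p + q + 1)%:R ^+ J).
  move=> C00 qp Hh; rewrite iter_bdiff12C iter_bdiff2_transpose.
  set N := (p + q + 1)%:R; have N0 : 0 < N by rewrite ltr0n addn1.
  have /(@ler_iter_bdiff1 _ (fun q p => iter J (@bdiff1 R) h p q))/le_trans : forall q', (q' <= q)%N ->
      `|iter J (@bdiff1 R) h p q'| <= C0 * (N ^+ (2 * K) * (2 ^+ J / N ^+ J)).
    move=> q' qq; rewrite (le_trans (Hh _ _ (leq_trans qq qp)))// ler_wpM2l//.
    have M0 : 0 < (p + q' + 1)%:R :> R by rewrite ltr0n addn1.
    apply: ler_pM; rewrite ?invr_ge0 ?exprn_ge0//.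
      by apply: lerXn2r; rewrite ?nnegrE ?ler0n// ler_nat leq_add2r leq_add2l.
    rewrite -!exprVn -exprMn; apply: lerXn2r; rewrite ?nnegrE ?invr_ge0 ?ler0n//.
      by rewrite divr_ge0// ltW.
    have pq' : (p + q + 1 <= 2 * (p + q' + 1))%N by clear -qp; lia.
    by rewrite ler_pdivlMr// ler_pdivrMl// mulrC -natrM ler_nat.
  by apply; rewrite le_eqVlt; apply/orP; left; apply/eqP; ring.
have [C1 C10 H1] := @ler_iter_bdiff1_log_grid R rho sigma x0 a c y0 b d J K r0 X0 A C Y0 B D.
(* The same estimate with the two directions exchanged, for [p <= q]. *)
have [C2 C20 H2] := @ler_iter_bdiff1_log_grid R rho sigma x0 c a y0 d b J K r0 X0 C A Y0 D B.
exists (2 ^+ J * 2 ^+ J * (C1 + C2)) => [|G M DG HG M0 p q].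
  by rewrite !mulr_ge0// ?exprn_ge0// addr_ge0.
have N0 p' q' : 0 <= (p' + q' + 1)%:R ^+ (2 * K) / (p' + q' + 1)%:R ^+ J :> R.
  by rewrite divr_ge0// exprn_ge0.
have t0 : 0 <= 2 ^+ J * 2 ^+ J :> R by rewrite mulr_ge0 ?exprn_ge0.
have [qp|/ltnW pq] := leqP q p.
  apply: le_trans (half (C1 * M) _ _ _ _ qp (H1 _ _ DG HG M0)) _; first exact: mulr_ge0.
  by rewrite ler_wpM2r// -!mulrA !ler_wpM2l ?exprn_ge0// ler_wpM2r// lerDl.
rewrite -iter_bdiff12_transpose.
have -> : (fun p q => log_grid x0 a c y0 b d G q p) = log_grid x0 c a y0 d b G.
  by apply/funext => p'; apply/funext => q'; rewrite /log_grid /lin_form !(addrAC _ _ (_ * q'%:R)).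
apply: le_trans (half (C2 * M) _ _ _ _ pq (H2 _ _ DG HG M0)) _; first exact: mulr_ge0.
rewrite [(q + p)%N]addnC.
by rewrite ler_wpM2r// -!mulrA !ler_wpM2l ?exprn_ge0// ler_wpM2r// lerDr.
Qed.

(** The condition [2 K + 4 <= J] turns the decay into [N^-4], where summability asks for an exponent
    above 2. Real and imaginary parts are estimated separately, whence a factor 2 in the
    constant. *)
Lemma l1_bound_bdiff12_clog_grid (x0 a c y0 b d : R) (J K : nat) :
  [/\ 0 < x0, 0 < a, 0 < c & [/\ 0 < y0, 0 < b & 0 < d]] -> (2 * K + 4 <= J)%N ->
  exists2 C, 0 <= C & forall (F : nat -> R -> R[i]) B,
  (forall k l, cderive (F k) l (F k.+1 l)) ->
  (forall k l, (k <= J)%N -> normc (F k l) <= B * expR `|l| ^+ K) -> 0 <= B ->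
  l1_bound (iter J (@bdiff12 _) (clog_grid x0 a c y0 b d F)) (C * B).
Proof.
move=> [x0p ap cp [y0p bp dp]] KJ.
pose rho := Num.min (Num.min (Num.min x0 a) (Num.min c y0)) (Num.min b d).
pose sigma := x0 + a + c + y0 + b + d.
have r0 : 0 < rho by rewrite !lt_min x0p ap cp y0p bp dp.
have rs u : u \in [:: x0; a; c; y0; b; d] -> rho <= u <= sigma.
  by rewrite !inE => /or4P[|||/or3P[]] /eqP ->; rewrite /rho !ge_min lexx ?orbT /sigma/=; lra.
have [||||||C C0 HC] := @ler_bdiff12_log_grid rho sigma x0 a c y0 b d J K r0;
  rewrite ?rs ?inE ?eqxx ?orbT//.
have [|M M0 HM] := @l1_bound_power R 4; first by rewrite ltr_nat.
exists (2 * C * M) => [|F B DF HF B0]; first by rewrite !mulr_ge0.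
have -> : 2 * C * M * B = (2 * C * B) * M by ring.
apply: HM => [|p q]; first by rewrite !mulr_ge0.
rewrite (le_trans (normc_le_ReIm _))//.
set N := (p + q + 1)%:R; have N0 : 0 < N by rewrite ltr0n addn1.
have decay : N ^+ (2 * K) / N ^+ J <= expR (- 4 * ln N).
  have -> : expR (- 4 * ln N) = N ^- 4.
    by rewrite mulNr expRN mulrC expRM_natr lnK.
  rewrite ler_pdivrMr ?exprn_gt0// ler_pdivlMl ?exprn_gt0// -exprD.
  by apply: ler_weXn2l; [rewrite ler1n addn1|rewrite addnC].
have -> : 2 * C * B * expR (- 4 * ln N) = C * B * expR (- 4 * ln N) + C * B * expR (- 4 * ln N) by ring.
have part (f : {additive R[i] -> R}) : (forall z, `|f z| <= normc z) ->
    (forall k (l : R), is_derive l 1 (f \o F k) (f (F k.+1 l))) ->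
    `|f (iter J (@bdiff12 _) (clog_grid x0 a c y0 b d F) p q)| <= C * B * expR (- 4 * ln N).
  move=> fle fD; rewrite morph_iter_bdiff12; last exact: raddfB.
  rewrite (le_trans (HC (fun k => f \o F k) B fD _ B0 p q))//.
    by move=> k l kJ; rewrite (le_trans (fle _))// HF.
  by rewrite ler_wpM2l// mulr_ge0.
apply: lerD; first by apply: part => [|k l]; [exact: Re_le_normc|have [] := DF k l].
by apply: part => [|k l]; [exact: Im_le_normc|have [] := DF k l].
Qed.

End ComplexDecay.

(** * Complex exponentials and Taylor remainders in the exponent *)

Section ComplexExponential.
Variable R : realType.
Implicit Types (z w v s : R[i]) (x l : R).

Definition cexp z : R[i] :=
  (expR (complex.Re z))%:C%C * (cos (complex.Im z) +i* sin (complex.Im z))%C.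

Lemma cexpD z w : cexp (z + w) = cexp z * cexp w.
Proof.
case: z w => a b [c d]; rewrite /cexp /= expRD cosD sinD; simpc.
by congr (_ +i* _)%C; ring.
Qed.

Lemma cexp0 : cexp 0 = 1.
Proof. by rewrite /cexp /= expR0 cos0 sin0; simpc. Qed.

Lemma cexpN z : cexp (- z) = (cexp z)^-1.
Proof.
have h : cexp z * cexp (- z) = 1 by rewrite -cexpD subrr cexp0.
have n0 : cexp z != 0 by apply: contra_eq_neq h => ->; rewrite mul0r eq_sym oner_eq0.
by rewrite -[RHS]mulr1 -h mulKf.
Qed.

Lemma cexpMn z n : cexp (z *+ n) = cexp z ^+ n.
Proof.
elim: n => [|n IH]; first by rewrite mulr0n cexp0 expr0.
by rewrite mulrS cexpD IH exprS.
Qed.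

Lemma normc_cexp z : normc (cexp z) = expR (complex.Re z).
Proof.
rewrite /cexp Normc.normcM normc_real ger0_norm ?expR_ge0//.
by rewrite /= cos2Dsin2 sqrtr1 mulr1.
Qed.

Lemma Re_mul_real z x : complex.Re (z * x%:C%C) = complex.Re z * x.
Proof. by case: z => a b; simpc. Qed.

Lemma Im_mul_real z x : complex.Im (z * x%:C%C) = complex.Im z * x.
Proof. by case: z => a b; simpc. Qed.

Lemma cpow_cexp x s : cpow x s = cexp (s * (ln x)%:C%C).
Proof. by rewrite /cexp Re_mul_real Im_mul_real. Qed.

Lemma normc_cexp_le v l : normc (cexp (v * l%:C%C)) <= expR (normc v * `|l|).
Proof.
rewrite normc_cexp Re_mul_real ler_expR (le_trans (ler_norm _))// normrM.
by rewrite ler_wpM2r// Re_le_normc.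
Qed.

Lemma is_derive_scale (a l : R) : is_derive l 1 (fun t => a * t) a.
Proof.
have -> : (fun t => a * t) = (fun t => 0 + a * t) by apply/funext => t; rewrite add0r.
exact: is_derive_line.
Qed.

Lemma cderive_cexp v l :
  cderive (fun l => cexp (v * l%:C%C)) l (v * cexp (v * l%:C%C)).
Proof.
case: v => a b; pose e (t : R) := expR (a * t); pose c (t : R) := cos (b * t).
pose s (t : R) := sin (b * t).
have DE : is_derive l 1 e (e l * a).
  exact: (@is_derive1_comp _ expR (fun t => a * t) _ _ _ _ (is_derive_scale _ _)).
have DC : is_derive l 1 c (- s l * b).
  exact: (@is_derive1_comp _ cos (fun t => b * t) _ _ _ _ (is_derive_scale _ _)).
have DS : is_derive l 1 s (c l * b).
  exact: (@is_derive1_comp _ sin (fun t => b * t) _ _ _ _ (is_derive_scale _ _)).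
have eqE t : cexp ((a +i* b)%C * t%:C%C) = (e t * c t +i* (e t * s t))%C.
  by rewrite /cexp; simpc.
split.
  have -> : (fun t => complex.Re (cexp ((a +i* b)%C * t%:C%C))) = e * c.
    by apply/funext => t; rewrite eqE.
  apply: is_derive_eq (is_deriveM DE DC) _; rewrite eqE /GRing.scale /=; ring.
have -> : (fun t => complex.Im (cexp ((a +i* b)%C * t%:C%C))) = e * s.
  by apply/funext => t; rewrite eqE.
apply: is_derive_eq (is_deriveM DE DS) _; rewrite eqE /GRing.scale /=; ring.
Qed.

Lemma cderive_cst z l : cderive (fun=> z) l 0.
Proof. by split; exact: is_derive_cst. Qed.

Lemma cderive_real l : cderive (fun l => l%:C%C) l 1.
Proof. by split; [exact: is_derive_id|exact: is_derive_cst]. Qed.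

Lemma cderiveD f g l df dg : cderive f l df -> cderive g l dg ->
  cderive (fun l => f l + g l) l (df + dg).
Proof.
move=> [f1 f2] [g1 g2]; split.
  have -> : (fun t => complex.Re (f t + g t)) =
     (fun t => complex.Re (f t)) + (fun t => complex.Re (g t)).
    by apply/funext => t; rewrite raddfD.
  by rewrite raddfD; exact: is_deriveD.
have -> : (fun t => complex.Im (f t + g t)) =
   (fun t => complex.Im (f t)) + (fun t => complex.Im (g t)).
  by apply/funext => t; rewrite raddfD.
by rewrite raddfD; exact: is_deriveD.
Qed.

Lemma Re_addc z w : complex.Re (z + w) = complex.Re z + complex.Re w.
Proof. by case: z w => a b [c d]. Qed.

Lemma Im_addc z w : complex.Im (z + w) = complex.Im z + complex.Im w.
Proof. by case: z w => a b [c d]. Qed.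

Lemma Re_mulc z w : complex.Re (z * w) =
  complex.Re z * complex.Re w - complex.Im z * complex.Im w.
Proof. by case: z w => a b [c d]. Qed.

Lemma Im_mulc z w : complex.Im (z * w) =
  complex.Re z * complex.Im w + complex.Im z * complex.Re w.
Proof. by case: z w => a b [c d]. Qed.

Lemma cderiveM f g l df dg : cderive f l df -> cderive g l dg ->
  cderive (fun l => f l * g l) l (df * g l + f l * dg).
Proof.
move=> [f1 f2] [g1 g2]; split.
  have -> : (fun t => complex.Re (f t * g t)) =
     (fun t => complex.Re (f t)) * (fun t => complex.Re (g t)) -
     (fun t => complex.Im (f t)) * (fun t => complex.Im (g t)).
    by apply/funext => t; rewrite Re_mulc.
  apply: is_derive_eq (is_deriveB (is_deriveM f1 g1) (is_deriveM f2 g2)) _.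
  rewrite Re_addc !Re_mulc /GRing.scale /=; ring.
have -> : (fun t => complex.Im (f t * g t)) =
   (fun t => complex.Re (f t)) * (fun t => complex.Im (g t)) +
   (fun t => complex.Im (f t)) * (fun t => complex.Re (g t)).
  by apply/funext => t; rewrite Im_mulc.
apply: is_derive_eq (is_deriveD (is_deriveM f1 g2) (is_deriveM f2 g1)) _.
rewrite Im_addc !Im_mulc /GRing.scale /=; ring.
Qed.

Lemma cderiveZ z f l df : cderive f l df -> cderive (fun l => z * f l) l (z * df).
Proof. by move=> /(cderiveM (cderive_cst z l)); rewrite mul0r add0r. Qed.

(** For complex values the mean value theorem survives only as an inequality; applying it to each
    component costs the factor 2. *)
Lemma ler_cmvt f df l M : (forall t, cderive f t (df t)) ->
  (forall t, `|t| <= `|l| -> normc (df t) <= M) -> normc (f l - f 0) <= 2 * M * `|l|.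
Proof.
move=> D b; have M0 : 0 <= M by rewrite (le_trans (normc_ge0 _) (b l _)).
have part (g dg : R -> R) : (forall t : R, is_derive t 1 g (dg t)) ->
    (forall t, `|t| <= `|l| -> `|dg t| <= M) -> `|g l - g 0| <= M * `|l|.
  move=> Dg bg; have [l0|/ltW l0] := lerP 0 l.
    rewrite -[X in _ * X]subr0 (ger0_norm l0); apply: (@ler_mvt _ g dg) => [//|t /andP[t0 tl]].
    by apply: bg; rewrite !ger0_norm// (le_trans t0).
  rewrite distrC (ler0_norm l0) -[- l]sub0r; apply: (@ler_mvt _ g dg) => [//|t /andP[t0 tl]].
  by apply: bg; rewrite !ler0_norm ?lerN2.
rewrite (le_trans (normc_le_ReIm _))// !raddfB -mulrA mulr_natl mulr2n.
apply: lerD.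
  apply: part (fun t => proj1 (D t)) _ => t tl.
  exact: le_trans (Re_le_normc _) (b t tl).
apply: part (fun t => proj2 (D t)) _ => t tl.
exact: le_trans (Im_le_normc _) (b t tl).
Qed.

Definition smooth_family (E : nat -> R -> R[i]) :=
  forall k l, cderive (E k) l (E k.+1 l).

Section ExpTwist.
Variables (s : R[i]).

Definition exp_shift (E : nat -> R -> R[i]) k l := E k.+1 l - s * E k l.

(* [(E e^{-sl})' = (E' - s E) e^{-sl}] *)
Definition exp_twist (E : nat -> R -> R[i]) k l :=
  iter k exp_shift E 0%N l * cexp (- s * l%:C%C).

Lemma smooth_exp_shift E : smooth_family E -> smooth_family (exp_shift E).
Proof.
move=> D k l; rewrite /exp_shift -!mulNr; apply: cderiveD; first exact: D.
have -> : (fun l => - (s * E k l)) = (fun l => - s * E k l).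
  by apply/funext => u; rewrite mulNr.
by apply: cderiveZ; exact: D.
Qed.

Lemma smooth_exp_twist E : smooth_family E -> smooth_family (exp_twist E).
Proof.
move=> D k l; have Dk : smooth_family (iter k exp_shift E).
  by elim: k => //= k; apply: smooth_exp_shift.
have := cderiveM (Dk 0%N l) (cderive_cexp (- s) l).
congr (cderive _ _ _); rewrite /exp_twist iterS {3}/exp_shift; ring.
Qed.

(** Each [exp_shift] costs a factor [1 + |s|], and [|exp(-s l)| <= exp(n |l|)]. *)
Lemma normc_exp_twist E B K n J : normc s <= n%:R ->
  (forall k l, normc (E k l) <= B * expR `|l| ^+ K) ->
  forall k l, (k <= J)%N ->
  normc (exp_twist E k l) <= (1 + normc s) ^+ J * B * expR `|l| ^+ (K + n).
Proof.
move=> sn HE k l kJ; have B0 : 0 <= B.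
  have := le_trans (normc_ge0 _) (HE 0%N 0); rewrite normr0 expR0 expr1n.
  by rewrite mulr1.
have s0 := normc_ge0 s; have e0 : 0 <= B * expR `|l| ^+ K.
  by rewrite mulr_ge0// exprn_ge0// expR_ge0.
have shiftB j i : normc (iter j exp_shift E i l) <= (1 + normc s) ^+ j * (B * expR `|l| ^+ K).
  elim: j i => [|j IH] i; first by rewrite mul1r.
  rewrite iterS /exp_shift (le_trans (ler_normcB _ _))// Normc.normcM exprS -mulrA.
  by rewrite mulrDl mul1r lerD// ler_wpM2l.
rewrite /exp_twist Normc.normcM exprD !mulrA; apply: ler_pM; rewrite ?normc_ge0//.
  rewrite -mulrA (le_trans (shiftB k 0%N))// ler_wpM2r//.
  by rewrite ler_weXn2l// lerDl.
rewrite (le_trans (normc_cexp_le _ _))// normcN.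
have -> : expR `|l| ^+ n = expR (n%:R * `|l|) by rewrite mulrC expRM_natr.
by rewrite ler_expR ler_wpM2r.
Qed.

End ExpTwist.

(** This family and the next two are the parts of [exp(v l) = 1 + v l + remainder], with all their
    derivatives. Multiplied by [exp(-s l)] at [l = ln N], they expand [N^-(s - v)] around [s]. *)
Definition const_family (k : nat) l : R[i] := if k is 0%N then 1 else 0.

Definition log_family (k : nat) l : R[i] :=
  match k with 0%N => l%:C%C | 1%N => 1 | _ => 0 end.

Definition rem_family v (k : nat) l : R[i] :=
  match k with
  | 0%N => cexp (v * l%:C%C) - 1 - v * l%:C%C
  | 1%N => v * cexp (v * l%:C%C) - v
  | k => v ^+ k * cexp (v * l%:C%C)
  end.

Lemma smooth_const_family : smooth_family const_family.
Proof. by case=> [|k] l; exact: cderive_cst. Qed.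

Lemma smooth_log_family : smooth_family log_family.
Proof.
by case=> [|[|k]] l; [exact: cderive_real|exact: cderive_cst|exact: cderive_cst].
Qed.

Lemma smooth_rem_family v : smooth_family (rem_family v).
Proof.
have C (z : R[i]) f l df : cderive f l df -> cderive (fun l => f l - z) l df.
  by move=> Df; rewrite -[df]addr0; apply: cderiveD => //; exact: cderive_cst.
case=> [|[|k]] l /=.
- have : cderive (fun l => cexp (v * l%:C%C) + - v * l%:C%C - 1) l
      (v * cexp (v * l%:C%C) + - v * 1).
    apply: C; apply: cderiveD; first exact: cderive_cexp.
    by apply: cderiveZ; exact: cderive_real.
  rewrite mulr1; congr (cderive _ _ _).
  by apply/funext => t; rewrite mulNr addrAC.
- by apply: C; rewrite expr2 -mulrA; apply: cderiveZ; exact: cderive_cexp.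
- by rewrite [_ ^+ k.+3]exprSr -mulrA; apply: cderiveZ; exact: cderive_cexp.
Qed.

Let exp1 l : 1 <= expR `|l|.
Proof. by rewrite -expR0 ler_expR. Qed.

Let expn n l : 1 <= expR `|l| ^+ n.
Proof. by rewrite exprn_ege1// exp1. Qed.

Lemma normc_const_family k l : normc (const_family k l) <= 1 * expR `|l| ^+ 2.
Proof.
rewrite mul1r (le_trans _ (expn 2 l))//; case: k => [|k] /=.
  by rewrite expr1n expr0n addr0 sqrtr1.
by rewrite !expr0n addr0 sqrtr0.
Qed.

Lemma normc_log_family k l : normc (log_family k l) <= 1 * expR `|l| ^+ 2.
Proof.
rewrite mul1r; case: k => [|[|k]].
- rewrite [log_family _ _]/= normc_real.
  apply: (@le_trans _ _ (expR `|l|)); last by rewrite expr2 ler_peMl ?expR_ge0 ?exp1.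
  by rewrite (le_trans _ (expR_ge1Dx _))// lerDr.
- by rewrite [log_family _ _]/= Normc.normc1 expn.
- by rewrite [log_family _ _]/= Normc.normc0 (le_trans ler01 (expn _ _)).
Qed.

(** From order 2 on the factor [v^2] is explicit. Orders 1 and 0 vanish at [l = 0], so two mean
    value steps keep [v^2] and introduce at most [l^2], absorbed in a second exponential. The 8 is
    made of the two factors 2 of [ler_cmvt] and the 2 of [l^2 <= 2 exp |l|]. *)
Lemma normc_rem_family v k l : normc v <= 1 ->
  normc (rem_family v k l) <= 8 * normc v ^+ 2 * expR `|l| ^+ 2.
Proof.
move=> v1; have v0 := normc_ge0 v; have v20 : 0 <= normc v ^+ 2 by apply: sqr_ge0.
have e0 (t : R) : 0 <= expR `|t| by exact: expR_ge0.
have cb t : normc (cexp (v * t%:C%C)) <= expR `|t|.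
  by rewrite (le_trans (normc_cexp_le _ _))// ler_expR ler_piMl.
have R2 j t : normc (rem_family v j.+2 t) <= normc v ^+ 2 * expR `|t|.
  rewrite [rem_family _ _ _]/= Normc.normcM normcX; apply: ler_pM => //.
  - exact: exprn_ge0.
  - exact: normc_ge0.
  - by rewrite -addn2 exprD ler_piMl// exprn_ile1.
have R1 t : normc (rem_family v 1 t) <= 2 * (normc v ^+ 2 * expR `|t|) * `|t|.
  have := @ler_cmvt (rem_family v 1) (rem_family v 2) t (normc v ^+ 2 * expR `|t|).
  rewrite [X in _ - X](_ : _ = 0) ?subr0 => [|]; last first.
    by rewrite /= mulr0 cexp0 mulr1 subrr.
  apply=> [u|u ut]; first exact: smooth_rem_family.
  by rewrite (le_trans (R2 0%N u))// ler_wpM2l// ler_expR.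
have R0 t : normc (rem_family v 0 t) <= 2 * (2 * (normc v ^+ 2 * expR `|t|) * `|t|) * `|t|.
  have := @ler_cmvt (rem_family v 0) (rem_family v 1) t (2 * (normc v ^+ 2 * expR `|t|) * `|t|).
  rewrite [X in _ - X](_ : _ = 0) ?subr0 => [|]; last first.
    by rewrite /= mulr0 cexp0 subrr subr0.
  apply=> [u|u ut]; first exact: smooth_rem_family.
  rewrite (le_trans (R1 u))// ler_pM ?mulr_ge0// ler_wpM2l// ler_wpM2l//.
  by rewrite ler_expR.
have l1 : `|l| <= expR `|l| by rewrite (le_trans _ (expR_ge1Dx _))// lerDr.
have l2 : `|l| ^+ 2 <= 2 * expR `|l|.
  have := @expR_ge1Dxn _ `|l| 1 (normr_ge0 _); rewrite (_ : 2`!%:R = 2 :> R)//; lra.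
case: k => [|[|k]].
- rewrite (le_trans (R0 l))//.
  have -> : 2 * (2 * (normc v ^+ 2 * expR `|l|) * `|l|) * `|l| =
     4 * normc v ^+ 2 * expR `|l| * `|l| ^+ 2 by ring.
  have -> : 8 * normc v ^+ 2 * expR `|l| ^+ 2 =
     4 * normc v ^+ 2 * expR `|l| * (2 * expR `|l|) by ring.
  by rewrite ler_wpM2l// !mulr_ge0.
- rewrite (le_trans (R1 l))//.
  have -> : 2 * (normc v ^+ 2 * expR `|l|) * `|l| =
     normc v ^+ 2 * expR `|l| * (2 * `|l|) by ring.
  have -> : 8 * normc v ^+ 2 * expR `|l| ^+ 2 =
     normc v ^+ 2 * expR `|l| * (8 * expR `|l|) by ring.
  by rewrite ler_wpM2l ?mulr_ge0//; have := e0 l; lra.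
- rewrite (le_trans (R2 k l))//.
  have -> : 8 * normc v ^+ 2 * expR `|l| ^+ 2 =
     normc v ^+ 2 * expR `|l| * (8 * expR `|l|) by ring.
  by rewrite ler_peMr ?mulr_ge0//; have := exp1 l; lra.
Qed.

End ComplexExponential.

(** * Complex differentiability from a quadratic estimate *)

Section ComplexDifferentiability.
Variable R : realType.

Lemma derivable_quadratic (f : R[i] -> R[i]) (s D : R[i]) (C : R) :
  (forall h, normc h <= 1 -> normc (f (s + h) - f s - h * D) <= C * normc h ^+ 2) ->
  derivable (f : R[i]^o -> R[i]^o) s 1.
Proof.
move=> H; apply/cvg_ex; exists D; apply/cvgrPdist_lt => e e0.
(* In the partial order of [R[i]] a positive element is real. *)
have [e' eE] : exists e' : R, e = e'%:C%C.
  case: e e0 => a b /ltW; rewrite lecE /= => /andP[/eqP b0 _]; exists a.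
  by rewrite b0.
have e'0 : 0 < e' by move: e0; rewrite eE ltcR.
have C1 : 0 < `|C| + 1 by rewrite ltr_wpDl.
pose d : R := Num.min 1 (e' / (`|C| + 1)).
have d0 : 0 < d by rewrite lt_min ltr01 divr_gt0.
near=> h.
have h0 : h != 0 by near: h; exact: nbhs_dnbhs_neq.
have hd : normc h < d.
  have : `|h| < d%:C%C by near: h; apply: dnbhs0_lt; rewrite ltcR.
  by rewrite norm_normc ltcR.
rewrite eE norm_normc ltcR.
have nh : 0 < normc h.
  by rewrite lt0r normc_ge0 andbT; apply: contra_neq h0; apply: Normc.eq0_normc.
have -> : D - h^-1 *: ((f \o shift s) (h *: (1 : R[i]^o)) - f s) =
    - (h^-1 * (f (s + h) - f s - h * D)).
  rewrite /= [h *: _]mulr1 [h + s]addrC -{1}[D](mulKf h0).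
  by rewrite [X in _ - X](_ : _ = h^-1 * (f (s + h) - f s))// -mulrBr -opprB mulrN.
rewrite normcN Normc.normcM Normc.normcV ltr_pdivrMl//.
move: hd; rewrite lt_min => /andP[/ltW h1 hC]; rewrite (le_lt_trans (H h h1))//.
have {}hC : normc h * (`|C| + 1) < e' by rewrite -ltr_pdivlMr.
rewrite expr2 mulrCA ltr_pM2l// mulrC (le_lt_trans _ hC)// ler_pM2l//.
by rewrite (le_trans (ler_norm C))// lerDl.
Unshelve. all: by end_near.
Qed.

Lemma derivable_scale (c : R[i]) (f : R[i] -> R[i]) s :
  derivable (f : R[i]^o -> R[i]^o) s 1 ->
  derivable ((fun s => c * f s) : R[i]^o -> R[i]^o) s 1.
Proof. by move=> H; have D := @derivableZ _ _ _ _ c _ _ H; exact: D. Qed.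

Lemma derivable_analytic (f : R[i] -> R[i]) z :
  (forall s, derivable (f : R[i]^o -> R[i]^o) s 1) -> analytic_at f z.
Proof. by move=> H; rewrite /analytic_at; exact: filterE. Qed.

End ComplexDifferentiability.

(** * The regularized zeta function of a grid *)

Section GridZeta.
Variable R : realType.
Variables (x0 a c y0 b d : R) (z1 z2 : R[i]).
Hypotheses (pos : [/\ 0 < x0, 0 < a, 0 < c & [/\ 0 < y0, 0 < b & 0 < d]])
  (n1 : normc z1 = 1) (n2 : normc z2 = 1) (z1N1 : z1 != 1) (z2N1 : z2 != 1).

Definition log_norm p q : R := ln (lin_form x0 a c p q) + ln (lin_form y0 b d p q).

Definition zeta_grid (s : R[i]) p q := cexp (- s * (log_norm p q)%:C%C).

Let twist_grid s E p q := clog_grid x0 a c y0 b d (exp_twist s E) p q.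

Let twist_gridE s E p q :
  twist_grid s E p q = E 0%N (log_norm p q) * zeta_grid s p q.
Proof. by []. Qed.

(* For fixed s, one order J of summation by parts serves all three families. *)
Lemma reg_sum_zeta_grid_expansion s :
  exists J, exists C, forall v, normc v <= 1 -> exists S D r,
  [/\ reg_sum_at z1 z2 (zeta_grid s) J S,
      reg_sum_at z1 z2 (fun p q => (log_norm p q)%:C%C * zeta_grid s p q) J D,
      reg_sum_at z1 z2 (zeta_grid (s - v)) J (S + (v * D + r)) &
      normc r <= C * normc v ^+ 2].
Proof.
pose n := (Num.trunc (normc s)).+1; have sn : normc s <= n%:R.
  by rewrite ltW// truncnS_gt// normc_ge0.
(* The exponent 2 bounds all three families and [n] absorbs [exp(-s l)]; [J] is then the least order
   that the summability estimate admits. *)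
pose K := (2 + n)%N; pose J := (2 * K + 4)%N.
have [C C0 HC] := l1_bound_bdiff12_clog_grid pos (leqnn J).
pose T := (1 + normc s) ^+ J.
have T0 : 0 <= T by rewrite exprn_ge0// addr_ge0// normc_ge0.
have twistL1 E B : smooth_family E -> 0 <= B ->
    (forall k l, normc (E k l) <= B * expR `|l| ^+ 2) ->
    l1_bound (iter J (@bdiff12 _) (twist_grid s E)) (C * (T * B)).
  move=> DE B0 HE; apply: HC; first exact: smooth_exp_twist.
    by move=> k l kJ; apply: normc_exp_twist.
  exact: mulr_ge0.
have [S HS] : exists S, reg_sum_at z1 z2 (zeta_grid s) J S.
  have -> : zeta_grid s = twist_grid s (@const_family R).
    by apply/funext => p; apply/funext => q; rewrite twist_gridE mul1r.
  apply: reg_sum_at_ex => //; exists (C * (T * 1)).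
  exact: twistL1 (@smooth_const_family R) ler01 (@normc_const_family R).
have [D HD] : exists D,
    reg_sum_at z1 z2 (fun p q => (log_norm p q)%:C%C * zeta_grid s p q) J D.
  apply: reg_sum_at_ex => //; exists (C * (T * 1)).
  exact: twistL1 (@smooth_log_family R) ler01 (@normc_log_family R).
exists J, ((normc ((1 - z1) * (1 - z2)) ^+ J)^-1 * (C * (T * 8))) => v v1.
have B0 : 0 <= 8 * normc v ^+ 2 by rewrite mulr_ge0// sqr_ge0.
have L1 := twistL1 (rem_family v) _ (smooth_rem_family v) B0 (fun k l => normc_rem_family k l v1).
have [r Hr] : exists r, reg_sum_at z1 z2 (twist_grid s (rem_family v)) J r.
  by apply: reg_sum_at_ex => //; exists (C * (T * (8 * normc v ^+ 2))).
exists S, D, r; split; [exact: HS|exact: HD| |].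
  have -> : zeta_grid (s - v) = (fun p q => zeta_grid s p q +
      (v * ((log_norm p q)%:C%C * zeta_grid s p q) + twist_grid s (rem_family v) p q)).
    apply/funext => p; apply/funext => q; rewrite twist_gridE /zeta_grid /=.
    by rewrite opprB mulrDl cexpD; ring.
  by apply: reg_sum_atD HS (reg_sum_atD (reg_sum_atM v HD) Hr).
have := reg_sum_at_le n1 n2 z1N1 z2N1 L1 Hr; rewrite !mulrA; exact.
Qed.

Lemma reg_sum_zeta_grid_ex s : exists S, reg_sum z1 z2 (zeta_grid s) S.
Proof.
have [J [C /(_ 0)[|S [_ [_ [HS _ _ _]]]]]] := reg_sum_zeta_grid_expansion s.
  by rewrite Normc.normc0.
by exists S, J.
Qed.

(** With [v = - h] the expansion reads [Z (s + h) = Z s - h D + r], with [r] quadratic in [h].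
    Uniqueness of regularized sums identifies the other terms with values of [Z] and shows that [D]
    does not depend on [h]. *)
Lemma derivable_reg_zeta (Z : R[i] -> R[i]) :
  (forall s, reg_sum z1 z2 (zeta_grid s) (Z s)) ->
  forall s, derivable (Z : R[i]^o -> R[i]^o) s 1.
Proof.
move=> HZ s; have [J [C H]] := reg_sum_zeta_grid_expansion s.
have [|S [D [_ [HS HD _ _]]]] := H 0; first by rewrite Normc.normc0.
apply: (@derivable_quadratic _ _ _ (- D) C) => h h1.
have [|S' [D' [r [HS' HD' HZ' Hr]]]] := H (- h); first by rewrite normcN.
rewrite opprK in HZ'; have uniq := reg_sum_uniq z1N1 z2N1.
rewrite (uniq _ _ _ (HZ (s + h)) (ex_intro _ J HZ')).
rewrite (uniq _ _ _ (HZ s) (ex_intro _ J HS')).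
rewrite (reg_sum_at_uniq z1N1 z2N1 HD HD').
have -> : S' + (- h * D' + r) - S' - h * - D' = r by ring.
by rewrite normcN in Hr.
Qed.

(** Each linear form is at least [rho (p + q + 1)], so the terms are at most a constant times
    [(p + q + 1)^(-2 Re s)], with [2 Re s > 2]. *)
Lemma l1_zeta_grid s : 1 < complex.Re s -> l1 (zeta_grid s).
Proof.
move=> s1; case: pos => x0p ap cp [y0p bp dp].
have [|M M0 HM] := @l1_bound_power R (complex.Re s *+ 2).
  by rewrite mulr2n; lra.
pose rho := Num.min (Num.min (Num.min x0 a) (Num.min c y0)) (Num.min b d).
have r0 : 0 < rho by rewrite !lt_min x0p ap cp y0p bp dp.
have rs u : u \in [:: x0; a; c; y0; b; d] -> rho <= u.
  by rewrite !inE => /or4P[|||/or3P[]] /eqP ->; rewrite /rho !ge_min lexx ?orbT.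
have lin u v w p q : rho <= u -> rho <= v -> rho <= w ->
    ln rho + ln (p + q + 1)%:R <= ln (lin_form u v w p q).
  move=> ru rv rw; have N0 : 0 < (p + q + 1)%:R :> R by rewrite ltr0n addn1.
  rewrite -lnM ?posrE//.
  have le1 : rho * (p + q + 1)%:R <= lin_form u v w p q.
    rewrite /lin_form !natrD !mulrDr mulr1.
    have := ler_wpM2r (ler0n R p) rv; have := ler_wpM2r (ler0n R q) rw; lra.
  by rewrite ler_ln ?posrE//; [rewrite mulr_gt0|apply: lt_le_trans le1; rewrite mulr_gt0].
pose B := expR (- complex.Re s * (ln rho *+ 2)).
exists (B * M); apply: HM => [|p q]; first exact: expR_ge0.
rewrite normc_cexp Re_mul_real -expRD ler_expR raddfN /=.
have h1 : ln rho + ln (p + q + 1)%:R <= ln (lin_form x0 a c p q).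
  by apply: lin; apply: rs; rewrite !inE eqxx ?orbT.
have h2 : ln rho + ln (p + q + 1)%:R <= ln (lin_form y0 b d p q).
  by apply: lin; apply: rs; rewrite !inE eqxx ?orbT.
have s0 : 0 <= complex.Re s by lra.
have := ler_wpM2l s0 (lerD h1 h2); rewrite -/(log_norm p q) !mulr2n; lra.
Qed.

(** Here order 0 already qualifies, and uniqueness identifies the ordinary sum with the regularized
    one. *)
Lemma reg_sum_zeta_grid s S : 1 < complex.Re s -> reg_sum z1 z2 (zeta_grid s) S ->
  dsum_cvg (twist z1 z2 (zeta_grid s)) S.
Proof.
move=> s1 HS; have L := l1_zeta_grid s1.
have [S' [L' C']] := @reg_sum_at_ex _ z1 z2 (zeta_grid s) 0 n1 n2 z1N1 z2N1 L.
rewrite (reg_sum_uniq z1N1 z2N1 HS (ex_intro _ 0%N (conj L' C'))).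
by move: C'; rewrite expr0 mul1r.
Qed.

End GridZeta.

(** * Binomial series and the operator [fps2_Delta] *)

Section ProductSeries.
Variable K : numFieldType.
Implicit Types (f g : nat -> K) (u v : K) (p q : fps2 K).

Definition conv f g n := \sum_(a < n.+1) f a * g (n - a)%N.

(** Both [1 + X_i] and the binomial series factor in this way, which reduces their products to
    convolutions in one variable. *)
Definition tens f g : fps2 K := fun i j => f i * g j.

Lemma fps2_mul_tens f g f' g' :
  fps2_mul (tens f g) (tens f' g') = tens (conv f f') (conv g g').
Proof.
apply/funext => i; apply/funext => j; rewrite /tens /conv big_distrlr.
by apply: eq_bigr => a _; apply: eq_bigr => b _; rewrite mulrACA.
Qed.

Lemma binomial_coef0 u : binomial_coef u 0 = 1.
Proof. by rewrite /binomial_coef big_ord0 divr1. Qed.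

Lemma binomial_coefS u n :
  n.+1%:R * binomial_coef u n.+1 = (u - n%:R) * binomial_coef u n.
Proof.
rewrite /binomial_coef big_ord_recr /= factS natrM.
have n0 : n.+1%:R != 0 :> K by rewrite pnatr_eq0.
have f0 : n`!%:R != 0 :> K by rewrite pnatr_eq0 -lt0n fact_gt0.
by move: n0 f0; move: (n.+1%:R : K) (n`!%:R : K) => x y x0 y0; field; rewrite x0 y0.
Qed.

(** Vandermonde's identity: both sides satisfy the recursion [(n + 1) d_(n+1) = (u + v - n) d_n].
    For the convolution, [n + 1] is split as [a + (n + 1 - a)], which is Leibniz's rule on
    coefficients. *)
Lemma conv_binomial u v :
  conv (binomial_coef u) (binomial_coef v) = binomial_coef (u + v).
Proof.
have := binomial_coefS u; have := binomial_coef0 u.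
have := binomial_coefS v; have := binomial_coef0 v.
have := binomial_coefS (u + v); have := binomial_coef0 (u + v).
move: (binomial_coef (u + v)) (binomial_coef v) (binomial_coef u) => d c b.
move=> d0 dS c0 cS b0 bS; apply/funext => n; elim: n => [|n IH].
  by rewrite /conv big_ord_recl big_ord0 addr0 b0 c0 d0 mulr1.
have n0 : n.+1%:R != 0 :> K by rewrite pnatr_eq0.
apply: (mulfI n0); rewrite dS -IH /conv.
rewrite mulr_sumr (eq_bigr (fun a : 'I_n.+2 => a%:R * b a * c (n.+1 - a)%N +
    b a * ((n.+1 - a)%:R * c (n.+1 - a)%N))); last first.
  move=> a _; have an : (a <= n.+1)%N by rewrite -ltnS.
  rewrite -[n.+1%:R](_ : a%:R + (n.+1 - a)%:R = _); last by rewrite -natrD subnKC.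
  by rewrite mulrDl !mulrA [b a * _]mulrC.
rewrite big_split /= big_ord_recl /= !mul0r add0r [X in _ + X]big_ord_recr /=.
rewrite subnn mul0r mulr0 addr0 -big_split mulr_sumr; apply: eq_bigr => a _ /=.
have an : (a <= n)%N by rewrite -ltnS.
rewrite bS subSS subSn// cS natrB//; ring.
Qed.

Let e : nat -> K := fun i => (i <= 1)%N%:R.
Let unit0 : nat -> K := fun i => (i == 0)%N%:R.

Let conv_unit0 f : conv f unit0 = f.
Proof.
apply/funext => n; rewrite /conv big_ord_recr /= subnn mulr1 big1 ?add0r// => a _.
by rewrite /unit0 subn_eq0 leqNgt ltn_ord mulr0.
Qed.

Let unit0_conv f : conv unit0 f = f.
Proof.
by apply/funext => n; rewrite /conv big_ord_recl /= subn0 mul1r big1 ?addr0// => a _; rewrite mul0r.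
Qed.

Let conv_e f n : conv e f n = f n + (if n is n'.+1 then f n' else 0).
Proof.
case: n => [|n]; first by rewrite /conv big_ord_recl big_ord0 mul1r subn0.
rewrite /conv 2!big_ord_recl /= !mul1r subn0 subSS subn0 big1 ?addr0// => a _.
by rewrite /e /= mul0r.
Qed.

(** In each variable [(1 + X) d/dX] multiplies [(1 + X)^u] by [u]: binomial series are eigenvectors
    of [Delta]. *)
Lemma fps2_Delta_1DXpow (u : K * K) :
  fps2_Delta (fps2_1DXpow u) = (fun i j => u.1 * u.2 * fps2_1DXpow u i j).
Proof.
case: u => u v; pose d f : nat -> K := fun n => n.+1%:R * f n.+1.
have -> : fps2_Delta (fps2_1DXpow (u, v)) = fps2_mul
    (fps2_mul (tens e unit0) (tens unit0 e)) (tens (d (binomial_coef u)) (d (binomial_coef v))).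
  rewrite /fps2_Delta; congr fps2_mul; last first.
    apply/funext => i; apply/funext => j.
    rewrite /fps2_d1 /fps2_d2 /fps2_1DXpow /tens /d /=.
    move: (binomial_coef u _) (binomial_coef v _) => x y.
    by rewrite !mulr_natl mulrnAl mulrnAr.
  congr fps2_mul; apply/funext => i; apply/funext => j.
    by rewrite /fps2_1DX1 /tens /e /unit0 -natrM mulnb.
  by rewrite /fps2_1DX2 /tens /e /unit0 -natrM mulnb.
rewrite !fps2_mul_tens conv_unit0 unit0_conv.
have E w : conv e (d (binomial_coef w)) = (fun n => w * binomial_coef w n).
  apply/funext => n; rewrite conv_e /d; case: n => [|n].
    by rewrite binomial_coefS subr0 addr0.
  by rewrite [n.+2%:R * _]binomial_coefS mulrBl subrK.
by rewrite !E; apply/funext => i; apply/funext => j; rewrite /tens /fps2_1DXpow mulrACA.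
Qed.

Lemma fps2_mul_1DXpow (u v : K * K) :
  fps2_mul (fps2_1DXpow u) (fps2_1DXpow v) = fps2_1DXpow (u.1 + v.1, u.2 + v.2).
Proof.
rewrite -[fps2_1DXpow u]/(tens _ _) -[fps2_1DXpow v]/(tens _ _) fps2_mul_tens.
by rewrite !conv_binomial.
Qed.

Definition Delta_coef0 M p := iter M (@fps2_Delta K) p 0%N 0%N.

Lemma iter_DeltaM M c p : iter M (@fps2_Delta K) (fun i j => c * p i j) =
  (fun i j => c * iter M (@fps2_Delta K) p i j).
Proof.
elim: M => //= M ->; apply/funext => i; apply/funext => j.
rewrite /fps2_Delta {1 3}/fps2_mul mulr_sumr; apply: eq_bigr => a _.
rewrite mulr_sumr; apply: eq_bigr => b _.
by rewrite /fps2_d1 /fps2_d2 -!mulrnAr mulrCA.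
Qed.

Lemma Delta_coef0M M c p : Delta_coef0 M (fun i j => c * p i j) = c * Delta_coef0 M p.
Proof. by rewrite /Delta_coef0 iter_DeltaM. Qed.

Lemma Delta_coef0_1DXpow M (u : K * K) : Delta_coef0 M (fps2_1DXpow u) = (u.1 * u.2) ^+ M.
Proof.
elim: M => [|M IH].
  by rewrite -[LHS]/(binomial_coef u.1 0 * binomial_coef u.2 0) !binomial_coef0 mulr1.
by rewrite /Delta_coef0 iterSr fps2_Delta_1DXpow -/(Delta_coef0 M _) Delta_coef0M IH exprS.
Qed.

Lemma Delta_coef0B M p q : Delta_coef0 M (fun i j => p i j - q i j) =
  Delta_coef0 M p - Delta_coef0 M q.
Proof.
rewrite /Delta_coef0; suff -> : iter M (@fps2_Delta K) (fun i j => p i j - q i j) =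
    (fun i j => iter M (@fps2_Delta K) p i j - iter M (@fps2_Delta K) q i j) => [//|].
elim: M => //= M ->; apply/funext => i; apply/funext => j.
rewrite /fps2_Delta {1 3 5}/fps2_mul -sumrB; apply: eq_bigr => a _.
rewrite -sumrB; apply: eq_bigr => b _.
by rewrite /fps2_d1 /fps2_d2 !mulrnBl mulrBr.
Qed.

(** Each application of [Delta] reads one further coefficient in each variable, so the induction
    runs over boxes of arbitrary size [n]. *)
Lemma eq_Delta_coef0 M p q :
  (forall i j, (i < M.+1)%N -> (j < M.+1)%N -> p i j = q i j) ->
  Delta_coef0 M p = Delta_coef0 M q.
Proof.
move=> pq; suff : forall i j, (i < 1)%N -> (j < 1)%N ->
    iter M (@fps2_Delta K) p i j = iter M (@fps2_Delta K) q i j by exact.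
rewrite -add1n in pq; elim: M 1%N pq => [|M IH] n pq; first by rewrite addn0 in pq.
have {}pq : forall i j, (i < n.+1 + M)%N -> (j < n.+1 + M)%N -> p i j = q i j.
  by move=> i j; rewrite addSnnS; apply: pq.
move=> i j iN jN; rewrite !iterS /fps2_Delta; apply: eq_bigr => a _; apply: eq_bigr => b _.
congr (_ * _); rewrite /fps2_d1 /fps2_d2 (IH n.+1 pq)// ltnS.
  exact: leq_ltn_trans (leq_subr _ _) iN.
exact: leq_ltn_trans (leq_subr _ _) jN.
Qed.

End ProductSeries.

(** * Differences of geometric sequences *)

Section GeometricDifferences.
Variable V : comNzRingType.
Implicit Types (f g : nat -> V) (c z u : V).

Definition seq_bdiff f (p : nat) := f p - (if p is p'.+1 then f p' else 0).

Lemma iter_bdiff12_prod J c f g :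
  iter J (@bdiff12 V) (fun p q => c * f p * g q) =
  (fun p q => c * iter J seq_bdiff f p * iter J seq_bdiff g q).
Proof.
elim: J => //= J ->; apply/funext => p; apply/funext => q.
rewrite /bdiff12 /bdiff1 /bdiff2 /shift1 /seq_bdiff.
by case: p q => [|p] [|q]; ring.
Qed.

Lemma iter_seq_bdiff_exp J u n :
  iter J seq_bdiff (GRing.exp u) (J + n)%N = u ^+ n * (u - 1) ^+ J.
Proof.
elim: J n => [|J IH] n; first by rewrite mulr1.
by rewrite iterS {1}/seq_bdiff addSn /= -addnS !IH !exprS; ring.
Qed.

(* The series [\sum_p z^p D^J(u^p)] equals (1 - z)^J / (1 - z u); this is its partial sum. *)
Lemma sum_iter_seq_bdiff_exp J n z u :
  (1 - z * u) * \sum_(p < J + n) z ^+ p * iter J seq_bdiff (GRing.exp u) p =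
  (1 - z) ^+ J - z ^+ (J + n) * (u ^+ n * (u - 1) ^+ J).
Proof.
elim: J => [|J IH].
  rewrite mulr1 expr0 -exprMn (eq_bigr (fun p : 'I__ => (z * u) ^+ p)).
    by rewrite -opprB mulNr -subrX1 opprB.
  by move=> p _; rewrite /= exprMn.
(* The shifted half of the difference reindexes to [z] times the same sum with one term fewer; the
   remaining term, at [p = J + n], is known in closed form. *)
have -> : \sum_(p < J.+1 + n) z ^+ p * iter J.+1 seq_bdiff (GRing.exp u) p =
    (1 - z) * \sum_(p < J + n) z ^+ p * iter J seq_bdiff (GRing.exp u) p +
    z ^+ (J + n) * (u ^+ n * (u - 1) ^+ J).
  rewrite (eq_bigr (fun p : 'I__ => z ^+ p * iter J seq_bdiff (GRing.exp u) p -
      z ^+ p * (if val p is p'.+1 then iter J seq_bdiff (GRing.exp u) p' else 0))).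
    rewrite sumrB addSn [X in X - _]big_ord_recr big_ord_recl /= mulr0 add0r.
    rewrite [X in _ - X = _](eq_bigr (fun p : 'I__ => z * (z ^+ p * iter J seq_bdiff (GRing.exp u) p))).
      rewrite -mulr_sumr iter_seq_bdiff_exp. ring.
    by move=> p _; rewrite exprS mulrA.
  by move=> p _; rewrite iterS {1}/seq_bdiff mulrBr.
rewrite mulrDr mulrCA IH addSn !exprS; ring.
Qed.

End GeometricDifferences.

(** * Power series modulo high powers of the variables *)

Section TruncatedSeries.
Variable K : numFieldType.
Implicit Types (P Q : {poly {poly K}}) (p q : fps2 K).

(** Series are replaced by polynomial representatives modulo the ideal generated by the [N]-th
    powers of the two variables, so that identities of commutative rings apply to them. *)
Definition null N P := forall i j, (i < N)%N -> (j < N)%N -> P`_i`_j = 0.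

Definition agree N P p := forall i j, (i < N)%N -> (j < N)%N -> P`_i`_j = p i j.

Definition trunc_poly N p : {poly {poly K}} := \poly_(i < N) \poly_(j < N) p i j.

Lemma agree_trunc N p : agree N (trunc_poly N p) p.
Proof. by move=> i j iN jN; rewrite !(coef_poly, iN, jN). Qed.

Lemma agreeC N c : agree N c%:P%:P (fps2C c).
Proof.
move=> i j _ _; rewrite coefC /fps2C; case: (i == 0%N); rewrite ?coef0// coefC.
by case: eqP.
Qed.

Lemma agreeB N P Q p q : agree N P p -> agree N Q q -> agree N (P - Q) (fps2_sub p q).
Proof. by move=> Pp Qq i j iN jN; rewrite !coefB Pp ?Qq. Qed.

Lemma agreeM N P Q p q : agree N P p -> agree N Q q -> agree N (P * Q) (fps2_mul p q).
Proof.
move=> Pp Qq i j iN jN; rewrite coefM coef_sum; apply: eq_bigr => a _.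
rewrite coefM; apply: eq_bigr => b _; rewrite Pp ?Qq//.
- exact: leq_ltn_trans (leq_subr _ _) iN.
- exact: leq_ltn_trans (leq_subr _ _) jN.
- exact: leq_trans (ltn_ord a) iN.
- exact: leq_trans (ltn_ord b) jN.
Qed.

Lemma agree_null N P Q p : agree N P p -> agree N Q p -> null N (P - Q).
Proof. by move=> Pp Qp i j iN jN; rewrite !coefB Pp ?Qp// subrr. Qed.

Lemma nullD N P Q : null N P -> null N Q -> null N (P + Q).
Proof. by move=> P0 Q0 i j iN jN; rewrite !coefD P0// Q0// addr0. Qed.

Lemma nullN N P : null N P -> null N (- P).
Proof. by move=> P0 i j iN jN; rewrite !coefN P0// oppr0. Qed.

Lemma nullM N P Q : null N Q -> null N (P * Q).
Proof.
move=> Q0 i j iN jN; rewrite coefM coef_sum big1// => a _; rewrite coefM big1// => b _.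
rewrite Q0 ?mulr0//; first exact: leq_ltn_trans (leq_subr _ _) iN.
exact: leq_ltn_trans (leq_subr _ _) jN.
Qed.

(** [P ^+ J] has no term of total degree below [J], and within the box the total degree is at most
    [2 N - 2]. This is why [2 N] differences suffice for the special values. *)
Lemma nullX N P J : P`_0`_0 = 0 -> (N + N <= J)%N -> null N (P ^+ J).
Proof.
move=> P0 NJ i j iN jN; have : (i + j < J)%N.
  by apply: leq_trans NJ; rewrite -addSn leq_add// ltnW.
elim: J i j {NJ iN jN} => // J IH i j ij.
rewrite exprS coefM coef_sum big1// => -[a aP] _; rewrite coefM big1// => -[b bP] _ /=.
have [ab0|ab0] := eqVneq (a + b)%N 0%N.
  by move/eqP: ab0; rewrite addn_eq0 => /andP[/eqP -> /eqP ->]; rewrite P0 mul0r.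
rewrite IH ?mulr0//; clear -ij aP bP ab0; lia.
Qed.

Variable M : nat.

Definition Delta_poly P := Delta_coef0 M (fun i j => P`_i`_j).

Lemma Delta_polyB : {morph Delta_poly : P Q / P - Q}.
Proof.
move=> P Q; rewrite /Delta_poly -Delta_coef0B; congr Delta_coef0.
by apply/funext => i; apply/funext => j; rewrite !coefB.
Qed.

Lemma Delta_polyM c P : Delta_poly (c%:P%:P * P) = c * Delta_poly P.
Proof.
rewrite /Delta_poly -Delta_coef0M; congr Delta_coef0.
by apply/funext => i; apply/funext => j; rewrite !coefCM.
Qed.

Lemma Delta_poly0 : Delta_poly 0 = 0.
Proof. by rewrite -(subrr 0) Delta_polyB subrr. Qed.

Lemma Delta_polyD : {morph Delta_poly : P Q / P + Q}.
Proof.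
move=> P Q; have DN : Delta_poly (- Q) = - Delta_poly Q.
  by rewrite -[- Q]sub0r Delta_polyB Delta_poly0 sub0r.
by rewrite -{1}[Q]opprK Delta_polyB DN opprK.
Qed.

Lemma Delta_poly_agree P p : agree M.+1 P p -> Delta_poly P = Delta_coef0 M p.
Proof. by move=> Pp; apply: eq_Delta_coef0. Qed.

Lemma Delta_poly_null P Q : null M.+1 (P - Q) -> Delta_poly P = Delta_poly Q.
Proof.
move=> H; apply: eq_Delta_coef0 => i j iM jM; apply/eqP; rewrite -subr_eq0 -!coefB.
by rewrite H.
Qed.

End TruncatedSeries.

(** * Special values as coefficients of the Shintani series *)

Section SpecialValues.
Variable K : numFieldType.
Variables (u v w : K * K) (z1 z2 : K) (M : nat).
Hypotheses (z1N1 : z1 != 1) (z2N1 : z2 != 1).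

Definition euler_factor (z : K) (u : K * K) : fps2 K :=
  fps2_sub (fps2C 1) (fps2_mul (fps2C z) (fps2_1DXpow u)).

(** The Shintani series without its constant factor, the character value of the coset
    representative. *)
Definition shintani_fps : fps2 K := fps2_mul (fps2_1DXpow w)
  (fps2_inv (fps2_mul (euler_factor z1 u) (euler_factor z2 v))).

Definition power_grid (p q : nat) : K :=
  ((w.1 + v.1 * q%:R + u.1 * p%:R) * (w.2 + v.2 * q%:R + u.2 * p%:R)) ^+ M.

Let N := M.+1.
Let J := (N + N)%N.
Let T p : {poly {poly K}} := trunc_poly N p.
Let U := T (fps2_1DXpow u).
Let V := T (fps2_1DXpow v).
Let W := T (fps2_1DXpow w).
Let I := T (fps2_inv (fps2_mul (euler_factor z1 u) (euler_factor z2 v))).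
Let D z P : {poly {poly K}} := 1 - z%:P%:P * P.

Let agree_exp t n : agree N (T (fps2_1DXpow t) ^+ n) (fps2_1DXpow (t.1 * n%:R, t.2 * n%:R)).
Proof.
elim: n => [|n IH].
  move=> i j _ _; rewrite expr0 !mulr0 coef1 /fps2_1DXpow /=.
  have b0 m : binomial_coef (0 : K) m = (m == 0)%N%:R.
    case: m => [|m]; first exact: binomial_coef0.
    by rewrite /binomial_coef big_ord_recl subr0 !mul0r.
  rewrite !b0; case: (i == 0%N); rewrite ?mul1r ?mul0r ?coef0//= coef1.
  by case: (j == 0%N).
have := agreeM (@agree_trunc _ N (fps2_1DXpow t)) IH; rewrite fps2_mul_1DXpow /= -exprS.
by rewrite -!nat1r !mulrDr !mulr1.
Qed.

Let power_gridE p q : power_grid p q = Delta_poly M (W * U ^+ p * V ^+ q).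
Proof.
have := agreeM (agreeM (@agree_trunc _ N (fps2_1DXpow w)) (agree_exp u p)) (agree_exp v q).
rewrite !fps2_mul_1DXpow /= => /Delta_poly_agree ->; rewrite Delta_coef0_1DXpow /=.
by rewrite /power_grid !(addrAC _ (_ * q%:R)).
Qed.

Let trunc_sub1_00 t : (T (fps2_1DXpow t) - 1)`_0`_0 = 0.
Proof.
rewrite !coefB (@agree_trunc _ N)// coef1 coef1 /=.
by rewrite /fps2_1DXpow !binomial_coef0 mulr1 subrr.
Qed.

Let iter_power_grid p q : iter J (@bdiff12 K) power_grid p q =
  Delta_poly M (W * iter J (@seq_bdiff _) (GRing.exp U) p * iter J (@seq_bdiff _) (GRing.exp V) q).
Proof.
rewrite -[RHS]/(Delta_poly M ((fun p q => W * iter J (@seq_bdiff _) (GRing.exp U) p *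
  iter J (@seq_bdiff _) (GRing.exp V) q) p q)) -iter_bdiff12_prod.
rewrite (morph_iter_bdiff12 _ _ _ _ (@Delta_polyB K M)); congr (iter J _ _ p q).
by apply/funext => a; apply/funext => b; rewrite power_gridE.
Qed.

Lemma iter_power_grid_eq0 p q : (J <= p)%N || (J <= q)%N ->
  iter J (@bdiff12 K) power_grid p q = 0.
Proof.
have tail t r : (J <= r)%N -> null N (iter J (@seq_bdiff _) (GRing.exp (T (fps2_1DXpow t))) r).
  move=> Jr; rewrite -(subnKC Jr) iter_seq_bdiff_exp; apply: nullM.
  by apply: nullX => //; exact: trunc_sub1_00.
rewrite iter_power_grid -(Delta_poly0 K M) => /orP[] H; apply: Delta_poly_null; rewrite subr0.
  by rewrite mulrC mulrA; apply: nullM; exact: tail.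
by apply: nullM; exact: tail.
Qed.

(** The sums [S] satisfy an equation after multiplication by the Euler factors; the comparison with
    the truncated inverse [I] takes place modulo null polynomials. *)
Lemma rsum_iter_power_grid :
  rsum (fun p q => z1 ^+ p * z2 ^+ q * iter J (@bdiff12 K) power_grid p q) J J =
  ((1 - z1) * (1 - z2)) ^+ J * Delta_coef0 M shintani_fps.
Proof.
pose S z P := \sum_(p < J) z%:P%:P ^+ p * iter J (@seq_bdiff _) (GRing.exp P) p : {poly {poly K}}.
have sumE : rsum (fun p q => z1 ^+ p * z2 ^+ q * iter J (@bdiff12 K) power_grid p q) J J =
    Delta_poly M (W * S z1 U * S z2 V).
  rewrite /S -mulrA big_distrlr mulr_sumr.
  rewrite (big_morph _ (@Delta_polyD K M) (@Delta_poly0 K M)); apply: eq_bigr => p _.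
  rewrite mulr_sumr (big_morph _ (@Delta_polyD K M) (@Delta_poly0 K M)); apply: eq_bigr => q _.
  rewrite iter_power_grid -!Delta_polyM !polyCM !polyC_exp; congr Delta_poly.
  move: (iter J _ (GRing.exp U) p) (iter J _ (GRing.exp V) q) => a b.
  rewrite -[RHS]/(W * ((z1%:P%:P ^+ p * a) * (z2%:P%:P ^+ q * b))); ring.
have DS z t : D z (T (fps2_1DXpow t)) * S z (T (fps2_1DXpow t)) =
    (1 - z%:P%:P) ^+ J - z%:P%:P ^+ J * (T (fps2_1DXpow t) - 1) ^+ J.
  by have := sum_iter_seq_bdiff_exp J 0 z%:P%:P (T (fps2_1DXpow t)); rewrite addn0 mul1r.
have DI : null N (D z1 U * D z2 V * I - 1).
  have c0 : fps2_mul (euler_factor z1 u) (euler_factor z2 v) 0%N 0%N != 0.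
    rewrite /fps2_mul !big_ord1 /= /euler_factor /fps2_sub /fps2_mul !big_ord1 /=.
    rewrite /fps2C /= /fps2_1DXpow !binomial_coef0 !mulr1.
    by rewrite mulf_neq0// subr_eq0 eq_sym.
  have Da z t : agree N (D z (T (fps2_1DXpow t))) (euler_factor z t).
    apply: agreeB; first exact: agreeC.
    by apply: agreeM; [exact: agreeC|exact: agree_trunc].
  have := agreeM (agreeM (Da z1 u) (Da z2 v)) (@agree_trunc _ N (fps2_inv (fps2_mul (euler_factor z1 u) (euler_factor z2 v)))).
  rewrite fps2_mulV// => DIa; apply: agree_null DIa _; exact: agreeC.
have E0 z t : null N (z%:P%:P ^+ J * (T (fps2_1DXpow t) - 1) ^+ J).
  by apply: nullM; apply: nullX => //; exact: trunc_sub1_00.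
rewrite sumE (Delta_poly_null (Q := (((1 - z1) * (1 - z2)) ^+ J)%:P%:P * (W * I))).
  rewrite Delta_polyM; congr (_ * _); apply: Delta_poly_agree.
  by apply: agreeM; exact: agree_trunc.
have cE : (((1 - z1) * (1 - z2)) ^+ J)%:P%:P =
    (1 - z1%:P%:P) ^+ J * (1 - z2%:P%:P) ^+ J :> {poly {poly K}}.
  by rewrite exprMn !polyCM !polyC_exp !polyCB.
(* With [a = (1 - z) ^+ J], Euler factors [d] and inverse [i], the difference of the two sides is a
   combination of [d1 d2 i - 1] and the two [d s - a], all of them null. *)
have split_ring (A : comNzRingType) (x s1 s2 a1 a2 d1 d2 i : A) :
    x * s1 * s2 - a1 * a2 * (x * i) = - (x * s1 * s2) * (d1 * d2 * i - 1) +
      (x * i * (d1 * s1 - a1) * (d2 * s2) + x * i * a1 * (d2 * s2 - a2)) by ring.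
rewrite cE (split_ring _ W (S z1 U) (S z2 V) _ _ (D z1 U) (D z2 V) I).
have E z t : null N (D z (T (fps2_1DXpow t)) * S z (T (fps2_1DXpow t)) - (1 - z%:P%:P) ^+ J).
  by rewrite DS addrAC subrr add0r; exact: nullN.
apply: nullD; first exact: nullM.
apply: nullD; last exact: nullM (E z2 v).
rewrite [_ * (D z2 V * S z2 V)]mulrC; apply: nullM; exact: nullM (E z1 u).
Qed.

End SpecialValues.

(** * From double series to unordered sums *)

Section IndexedSums.
Variables (R : realType) (T : choiceType) (phi : nat -> nat -> T) (D : set T).
Hypotheses (phi_inj : forall p q p' q', phi p q = phi p' q' -> p = p' /\ q = q')
  (phiD : forall p q, D (phi p q)) (phi_onto : forall x, D x -> exists p q, x = phi p q).

Lemma rsum_pred1 (V : nmodType) (G : T -> V) p0 q0 N : (p0 < N)%N -> (q0 < N)%N ->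
  rsum (fun p q => if phi p q == phi p0 q0 then G (phi p q) else 0) N N = G (phi p0 q0).
Proof.
move=> pN qN; rewrite /rsum (bigD1 (Ordinal pN))//= (bigD1 (Ordinal qN))//= eqxx.
rewrite !big1 ?addr0//.
  move=> p pp; apply: big1 => q _; case: eqP => // /phi_inj[e _].
  by move: pp; rewrite -val_eqE /= e eqxx.
move=> q qq; case: eqP => // /phi_inj[_ e].
by move: qq; rewrite -val_eqE /= e eqxx.
Qed.

(** A finite subset of [D] fits in a square of indices, and the sum over it becomes a square sum
    with the other points masked. *)
Lemma sum_rsum (V : nmodType) (G : T -> V) (s : seq T) :
  uniq s -> (forall x, x \in s -> D x) ->
  exists N0, forall N, (N0 <= N)%N -> \sum_(x <- s) G x =
    rsum (fun p q => if phi p q \in s then G (phi p q) else 0) N N.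
Proof.
elim: s => [_ _|x s IH /= /andP[xs us] sD].
  by exists 0%N => N _; rewrite big_nil /rsum big1// => p _; rewrite big1.
have sD' y : y \in s -> D y by move=> ys; apply: sD; rewrite inE ys orbT.
have [N0 HN] := IH us sD'.
have [p0 [q0 xE]] := phi_onto (sD x (mem_head x s)).
exists (maxn N0 (maxn p0 q0).+1) => N; rewrite geq_max gtn_max => /and3P[N0N pN qN].
rewrite big_cons (HN _ N0N) {1}xE -(rsum_pred1 G pN qN) -rsumD; apply: eq_rsum => p q _ _.
rewrite inE -xE; case: eqP => [->|_] /=; last by rewrite add0r.
by rewrite (negbTE xs) addr0.
Qed.

Lemma abs_summable_l1 (g : T -> R[i]) : l1 (fun p q => g (phi p q)) -> abs_summable D g.
Proof.
move=> [M HM]; rewrite /abs_summable /summable.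
apply: (@le_lt_trans _ _ M%:E); last exact: ltry.
apply: ge_ereal_sup => _ [A [finA AD] <-]; rewrite fsbig_finite//.
rewrite (eq_bigr (fun x => (normc (g x))%:E)); last first.
  by move=> x _; rewrite /= ger0_norm ?normc_ge0.
rewrite sumEFin lee_fin.
have fD x : x \in (fset_set A : seq T) -> D x.
  by move=> xA; apply: AD; move: xA; rewrite in_fset_set// inE.
have [N0 HN] := sum_rsum (fun x => normc (g x)) (fset_uniq _) fD.
rewrite (HN _ (leqnn _)) (le_trans _ (HM N0))//; apply: ler_rsum => p q.
by case: ifP => // _; exact: normc_ge0.
Qed.

(** A finite set containing the image of a large square exceeds it only by points outside the
    square, whose total norm is a tail of the absolutely convergent series. *)
Lemma has_sum_dsum (g : T -> R[i]) S : l1 (fun p q => g (phi p q)) ->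
  dsum_cvg (fun p q => g (phi p q)) S -> has_sum D g S.
Proof.
move=> [M HM] CS e e0; have e2 : 0 < e / 2 by rewrite divr_gt0.
pose r p q := normc (g (phi p q)); have r0 p q : 0 <= r p q by exact: normc_ge0.
have [N1 tail] : exists N1, forall a, (N1 <= a)%N -> rsum r a a - rsum r N1 N1 < e / 2.
  pose E := [set rsum r N N | N in [set: nat]].
  have supE : has_sup E.
    by split; [exists (rsum r 0 0), 0%N|exists M => _ [N _ <-]; exact: HM].
  have [_ [N _ <-] HN] := sup_adherent e2 supE; exists N => a Na.
  have : rsum r a a <= sup E by apply: ub_le_sup; [case: supE|exists a].
  lra.
have [N2 near] := CS _ e2; pose N := maxn N1 N2.
pose box := [seq phi p q | p <- iota 0 N, q <- iota 0 N].
pose X0 : {fset T} := [fset x in box]%fset.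
have boxP x : reflect (exists p q, [/\ (p < N)%N, (q < N)%N & x = phi p q]) (x \in X0).
  rewrite !inE; apply: (iffP allpairsP) => [[[p q] /= [pN qN ->]]|[p [q [pN qN ->]]]].
    by exists p, q; move: pN qN; rewrite !mem_iota.
  by exists (p, q); rewrite !mem_iota.
exists X0 => [x /boxP[p [q [_ _ ->]]] //|X X0X XD].
have fD x : x \in (X : seq T) -> D x by move=> xX; apply: XD.
have [N0 HN] := sum_rsum g (fset_uniq _) fD.
pose N' := maxn N0 N; have NN' : (N <= N')%N by exact: leq_maxr.
rewrite (HN N' (leq_maxl _ _)); set h := fun p q => if _ then _ else _.
have n1 := near N N (leq_maxr _ _) (leq_maxr _ _).
rewrite -[S](subrK (rsum (fun p q => g (phi p q)) N N)) -addrA.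
rewrite (le_lt_trans (ler_normcD _ _))//.
have n2 : normc (rsum (fun p q => g (phi p q)) N N - rsum h N' N') <= rsum r N' N' - rsum r N N.
  rewrite (rsum_widen _ NN' NN') (rsum_widen r NN' NN') -!rsumB.
  rewrite (le_trans (ler_normc_rsum _ _ _))//; apply: ler_rsum => p q.
  case: ifP => [/andP[pN qN]|_].
    have : phi p q \in X by apply: X0X; apply/boxP; exists p, q.
    by rewrite /h => ->; rewrite !subrr Normc.normc0.
  by rewrite sub0r subr0 normcN /h; case: ifP => // _; rewrite Normc.normc0.
have h1 : rsum r N1 N1 <= rsum r N N by apply: ler_rsum_widen => //; exact: leq_maxl.
have h2 := tail N' (leq_trans (leq_maxl _ _) NN').
lra.
Qed.

End IndexedSums.

(** * Rationality of the norm *)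

Section QuadraticNorm.
Variables (k : fieldExtType rat) (R : realType) (iota1 iota2 : {rmorphism k -> R}).

(* With w a generator, w^2 = b w + c and iota1 w, iota2 w are the two roots of
   X^2 - b X - c, so their sum and product are rational. *)
Lemma norm_rational : \dim {:k} = 2%N -> (exists x, iota1 x <> iota2 x) ->
  forall x, exists r : rat, iota1 x * iota2 x = ratr r.
Proof.
move=> dk [w wN] x.
have fr : free [:: (1 : k); w].
  rewrite free_cons span_seq1 seq1_free; apply/andP; split; last first.
    by apply: contra_notN wN => /eqP ->; rewrite !rmorph0.
  apply/vlineP => -[c cE]; apply: wN; have c0 : c != 0.
    by apply: contra_eq_neq cE => ->; rewrite scale0r oner_neq0.
  have -> : w = c^-1 *: 1 by rewrite cE scalerA mulVf// scale1r.
  by rewrite !rmorphZ_num !rmorph1.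
have coordE y : exists l m : rat, y = l *: 1 + m *: w.
  have sp : basis_of fullv [:: (1 : k); w] by rewrite basisEfree fr subvf dk.
  have : y \in <<[:: (1%R : k); w]>>%VS by rewrite (span_basis sp) memvf.
  rewrite span_cons span_seq1 => /memv_addP[u /vlineP[l ->] [v /vlineP[m ->] ->]].
  by exists l, m.
have [c [b wwE]] := coordE (w * w); have [l [m ->]] := coordE x.
set W1 := iota1 w; set W2 := iota2 w.
have q1 : W1 * W1 = ratr c + ratr b * W1.
  by rewrite -rmorphM wwE rmorphD !rmorphZ_num rmorph1 mulr1.
have q2 : W2 * W2 = ratr c + ratr b * W2.
  by rewrite -rmorphM wwE rmorphD !rmorphZ_num rmorph1 mulr1.
have d0 : W1 - W2 != 0 by rewrite subr_eq0; apply/eqP.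
(* The difference of the two quadratic equations, divided by [W1 - W2]. *)
have sE : W1 + W2 = ratr b.
  by apply: (mulIf d0); rewrite mulrDl !mulrBr q1 q2; ring.
have pE : W1 * W2 = - ratr c.
  have -> : W1 * W2 = (W1 + W2) * W1 - W1 * W1 by ring.
  by rewrite sE q1; ring.
exists (l * l + l * m * b - m * m * c).
rewrite !rmorphD !rmorphZ_num !rmorph1 -/W1 -/W2 !mulr1 rmorphN /= !rmorphM /=.
have -> : (ratr l + ratr m * W1) * (ratr l + ratr m * W2) =
  ratr l * ratr l + ratr l * ratr m * (W1 + W2) + ratr m * ratr m * (W1 * W2) by ring.
by rewrite sE pE; ring.
Qed.

End QuadraticNorm.

(** * Lattice points of the cone *)

Section ConeLattice.
Variables (k : fieldExtType rat) (I A : set k) (t1 t2 : k).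
Hypotheses (dk : \dim {:k} = 2%N) (fr : free [:: t1; t2]) (cosetA : lattice_coset I t1 t2 A).

Definition cone_point (p q : nat) : k := coset_repr A t1 t2 + t1 *+ p + t2 *+ q.

Let coord_inj (l m l' m' : rat) :
  l *: t1 + m *: t2 = l' *: t1 + m' *: t2 -> l = l' /\ m = m'.
Proof.
move=> e; pose F (i : 'I_2) := if i == 0 then l - l' else m - m'.
have F0 : \sum_(i < 2) F i *: [tuple t1; t2]`_i = 0.
  rewrite big_ord_recl big_ord1 /F /= !scalerBl addrACA -opprD e.
  by rewrite subrr.
have /freeP/(_ F F0) Fi : free [tuple t1; t2] by [].
by split; apply/eqP; rewrite -subr_eq0; apply/eqP; [exact: (Fi 0)|exact: (Fi 1)].
Qed.

Let repr_mem : A (coset_repr A t1 t2) /\ parallelogram t1 t2 (coset_repr A t1 t2).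
Proof.
have : (A `&` parallelogram t1 t2) (coset_repr A t1 t2).
  by rewrite (coset_reprP dk fr cosetA).
by [].
Qed.

Lemma coset_repr_mem : A (coset_repr A t1 t2). Proof. by case: repr_mem. Qed.

Lemma coset_repr_coord : parallelogram t1 t2 (coset_repr A t1 t2).
Proof. by case: repr_mem. Qed.

Lemma cone_point_inj p q p' q' : cone_point p q = cone_point p' q' -> p = p' /\ q = q'.
Proof.
rewrite /cone_point -!addrA => /addrI; rewrite -!scaler_nat => /coord_inj[/eqP h1 /eqP h2].
by move: h1 h2; rewrite !eqr_nat => /eqP -> /eqP ->.
Qed.

Lemma coset_translate (p q : int) : A (coset_repr A t1 t2 + (t1 *~ p + t2 *~ q)).
Proof.
have := coset_repr_mem; case: cosetA => a _ ->; set x := coset_repr _ _ _.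
case=> i _ [j _ xE]; exists (i + p) => //; exists (j + q) => //.
by rewrite -xE !mulrzDr -!addrA; congr (a + (_ + _)); rewrite addrCA.
Qed.

Lemma cone_point_mem p q : (A `&` cone t1 t2) (cone_point p q).
Proof.
split; first by have := coset_translate p q; rewrite addrA.
have [l [m [/andP[l0 _] /andP[m0 _] xE]]] := coset_repr_coord.
exists (l + p%:R), (m + q%:R); split; rewrite ?ltr_wpDr ?addr_ge0//.
by rewrite /cone_point xE -!scaler_nat !scalerDl -!addrA; congr (_ + _); rewrite addrCA.
Qed.

(** Comparing coordinates, [l = l' + p] with [l > 0] and [l' <= 1] gives [p > -1]; likewise
    [m = m' + q] with [m >= 0] and [m' < 1]. The half-open sides of the parallelogram match those of
    the cone. *)
Lemma cone_pointP x : (A `&` cone t1 t2) x -> exists p q, x = cone_point p q.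
Proof.
case=> Ax [l [m [l0 m0 xE]]].
have [l' [m' [/andP[l'0 l'1] /andP[m'0 m'1] yE]]] := coset_repr_coord.
have [p [q xpq]] : exists p q : int, x = coset_repr A t1 t2 + (t1 *~ p + t2 *~ q).
  have := coset_repr_mem; move: Ax; case: cosetA => a _ ->; set y := coset_repr _ _ _.
  move=> [i _ [j _ <-]] [i' _ [j' _ <-]]; exists (i - i'), (j - j').
  by rewrite !mulrzBr -addrA; congr (a + _); rewrite addrACA !subrKC.
have : l *: t1 + m *: t2 = (l' + p%:~R) *: t1 + (m' + q%:~R) *: t2.
  by rewrite -xE xpq yE !scalerDl !scaler_int addrACA.
case/coord_inj => lE mE; rewrite lE in l0; rewrite mE in m0.
have p0 : 0 <= p.
  have : (-1)%:~R < p%:~R :> rat by rewrite rmorphN /=; lra.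
  by rewrite ltr_int; lia.
have q0 : 0 <= q.
  have : (-1)%:~R < q%:~R :> rat by rewrite rmorphN /=; lra.
  by rewrite ltr_int; lia.
exists `|p|%N, `|q|%N; rewrite xpq /cone_point -addrA.
by rewrite -{1}(gez0_abs p0) -{1}(gez0_abs q0).
Qed.

End ConeLattice.

(** * Ideals and their characters *)

Section Characters.
Variables (k : fieldExtType rat) (R : realType) (I : set k) (xi : k -> R[i]).
Hypotheses (I_ideal : fractional_ideal I) (xi_char : torsion_character I xi).

Lemma ideal0 : I 0.
Proof. by case: (fid_neq0 I_ideal) => x Ix _; rewrite -(subrr x); apply: fid_sub. Qed.

Lemma idealN x : I x -> I (- x).
Proof. by move=> Ix; rewrite -sub0r; apply: fid_sub => //; exact: ideal0. Qed.

Lemma idealD x y : I x -> I y -> I (x + y).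
Proof. by move=> Ix Iy; rewrite -[y]opprK; apply: fid_sub => //; exact: idealN. Qed.

Lemma idealMn x n : I x -> I (x *+ n).
Proof.
by move=> Ix; elim: n => [|n IH]; [exact: ideal0|rewrite mulrS; apply: idealD].
Qed.

Lemma idealMz x z : I x -> I (x *~ z).
Proof.
by move=> Ix; case: z => n; [exact: idealMn|apply: idealN; exact: idealMn].
Qed.

Lemma char_neq0 x : I x -> xi x != 0.
Proof.
move=> Ix; have [n n0] := tchar_root xi_char Ix; apply: contra_eq_neq => ->.
by rewrite expr0n gtn_eqF// eq_sym oner_neq0.
Qed.

Lemma char0 : xi 0 = 1.
Proof.
apply: (mulfI (char_neq0 ideal0)); rewrite -(tchar_add xi_char) ?addr0 ?mulr1//; exact: ideal0.
Qed.

Lemma charMn x n : I x -> xi (x *+ n) = xi x ^+ n.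
Proof.
move=> Ix; elim: n => [|n IH]; first by rewrite mulr0n char0.
by rewrite mulrS (tchar_add xi_char) ?IH ?exprS//; exact: idealMn.
Qed.

Lemma normc_char x : I x -> normc (xi x) = 1.
Proof.
move=> Ix; have [n n0 /(congr1 (@Normc.normc R))] := tchar_root xi_char Ix.
rewrite normcX Normc.normc1 => /eqP; rewrite pexpr_eq1//; last exact: normc_ge0.
by move=> /eqP.
Qed.

(** [f] lies in the annihilator, so [xi (f x) = 1]; this places the character values in the
    cyclotomic field. *)
Lemma char_conductor f x :
  [set n : int | annihilator I xi n%:~R] = [set f%:Z * n | n in [set: int]] ->
  I x -> xi x ^+ f = 1.
Proof.
move=> fE Ix; have : [set n : int | annihilator I xi n%:~R] f%:Z.
  by rewrite fE; exists 1 => //; rewrite mulr1.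
by move=> [_ /(_ x Ix)]; rewrite mulrzl -[x *~ _]/(x *+ f) charMn.
Qed.

End Characters.

(** * Closure properties of subfields *)

Section DivringClosed.
Variables (F : fieldType) (S : {pred F}).
Hypothesis S_closed : GRing.divring_closed S.

Lemma divring_closedB x y : x \in S -> y \in S -> x - y \in S.
Proof. by case: S_closed => _ + _; apply. Qed.

Lemma divring_closed1 : 1 \in S. Proof. by case: S_closed. Qed.

Lemma divring_closed_div x y : x \in S -> y \in S -> x / y \in S.
Proof. by case: S_closed => _ _; apply. Qed.

Lemma divring_closed0 : 0 \in S.
Proof. by rewrite -(subrr 1) divring_closedB ?divring_closed1. Qed.

Lemma divring_closedN x : x \in S -> - x \in S.
Proof. by rewrite -sub0r; apply: divring_closedB; exact: divring_closed0. Qed.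

Lemma divring_closedD x y : x \in S -> y \in S -> x + y \in S.
Proof. by move=> Sx Sy; rewrite -[y]opprK divring_closedB ?divring_closedN. Qed.

Lemma divring_closedV x : x \in S -> x^-1 \in S.
Proof. by rewrite -div1r; apply: divring_closed_div; exact: divring_closed1. Qed.

Lemma divring_closedM x y : x \in S -> y \in S -> x * y \in S.
Proof. by move=> Sx Sy; rewrite -[y]invrK divring_closed_div ?divring_closedV. Qed.

Lemma divring_closedX x n : x \in S -> x ^+ n \in S.
Proof.
move=> Sx; elim: n => [|n IH]; first exact: divring_closed1.
by rewrite exprS divring_closedM.
Qed.

Lemma divring_closed_int (z : int) : z%:~R \in S.
Proof.
have nat_mem n : n%:R \in S.
  elim: n => [|n IH]; first exact: divring_closed0.
  by rewrite -nat1r divring_closedD ?divring_closed1.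
by case: z => n; [exact: nat_mem|apply: divring_closedN; exact: nat_mem].
Qed.

Lemma divring_closed_rat (r : rat) : ratr r \in S.
Proof. by rewrite /ratr divring_closed_div ?divring_closed_int. Qed.

Lemma divring_closed_rsum h a b : (forall p q, h p q \in S) -> rsum h a b \in S.
Proof.
move=> hS; apply: (big_ind (fun x => x \in S)) => [|x y|p _].
- exact: divring_closed0.
- exact: divring_closedD.
apply: (big_ind (fun x => x \in S)) => [|x y|q _]; last exact: hS.
  exact: divring_closed0.
exact: divring_closedD.
Qed.

Lemma divring_closed_bdiff12 J h : (forall p q, h p q \in S) ->
  forall p q, iter J (@bdiff12 F) h p q \in S.
Proof.
move=> hS; elim: J => //= J IH p q; rewrite /bdiff12 /bdiff1 /bdiff2 /shift1.
by case: p q => [|p] [|q]; rewrite ?divring_closedB ?divring_closed0.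
Qed.

End DivringClosed.

(** * Grids of finite support and values at nonpositive integers *)

Section FiniteSupport.
Variable R : realType.
Implicit Types h : nat -> nat -> R[i].

Lemma rsum_support (V : nmodType) (h : nat -> nat -> V) J a b :
  (forall p q, (J <= p)%N || (J <= q)%N -> h p q = 0) -> (J <= a)%N -> (J <= b)%N ->
  rsum h a b = rsum h J J.
Proof.
move=> h0 Ja Jb; rewrite [RHS](rsum_widen _ Ja Jb); apply: eq_rsum => p q _ _.
by case: ifP => // /negbT; rewrite negb_and -!leqNgt => /h0.
Qed.

Lemma dsum_cvg_support h J : (forall p q, (J <= p)%N || (J <= q)%N -> h p q = 0) ->
  dsum_cvg h (rsum h J J).
Proof.
move=> h0 e e0; exists J => a b Ja Jb; rewrite (rsum_support h0 Ja Jb) subrr.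
by rewrite Normc.normc0.
Qed.

Lemma l1_support h J : (forall p q, (J <= p)%N || (J <= q)%N -> h p q = 0) -> l1 h.
Proof.
move=> h0; exists (rsum (fun p q => normc (h p q)) J J) => N.
rewrite -(@rsum_support _ _ J (maxn J N) (maxn J N)) ?leq_maxl//; last first.
  by move=> p q /h0 ->; rewrite Normc.normc0.
by apply: ler_rsum_widen => [p q||]; rewrite ?leq_maxr// normc_ge0.
Qed.

(** After [2 (M + 1)] differences in each variable only finitely many terms remain, so both
    conditions of [reg_sum_at] become statements about one finite sum. *)
Lemma reg_sum_power_grid (u v w : R[i] * R[i]) z1 z2 M : z1 != 1 -> z2 != 1 ->
  reg_sum z1 z2 (power_grid u v w M) (Delta_coef0 M (shintani_fps u v w z1 z2)).
Proof.
move=> z11 z21; exists (M.+1 + M.+1)%N; have h0 := @iter_power_grid_eq0 _ u v w M.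
split; first exact: l1_support h0.
rewrite -rsum_iter_power_grid//; apply: dsum_cvg_support => p q /h0 h.
by rewrite /twist h mulr0.
Qed.

Lemma fps2_mulC (K : fieldType) (c : K) (p q : fps2 K) :
  fps2_mul (fps2_mul (fps2C c) p) q = (fun i j => c * fps2_mul p q i j).
Proof.
have -> : fps2_mul (fps2C c) p = (fun i j => c * p i j).
  apply/funext => i; apply/funext => j; rewrite /fps2_mul big_ord_recl big_ord_recl /=.
  rewrite /fps2C /= mulr1n !subn0 big1 ?addr0 => [|b _]; last by rewrite mul0r.
  by rewrite big1 ?addr0// => a _; rewrite big1// => b _; rewrite mul0r.
apply/funext => i; apply/funext => j; rewrite /fps2_mul mulr_sumr.
by apply: eq_bigr => a _; rewrite mulr_sumr; apply: eq_bigr => b _; rewrite mulrA.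
Qed.

Lemma cexp_real (x : R) : cexp x%:C%C = (expR x)%:C%C.
Proof. by rewrite /cexp /= cos0 sin0; simpc. Qed.

Lemma zeta_grid_power_grid (x0 a c y0 b d : R) M :
  [/\ 0 < x0, 0 < a, 0 < c & [/\ 0 < y0, 0 < b & 0 < d]] ->
  zeta_grid x0 a c y0 b d (- M%:R) =
  power_grid (a%:C%C, b%:C%C) (c%:C%C, d%:C%C) (x0%:C%C, y0%:C%C) M.
Proof.
move=> [x0p ap cp [y0p bp dp]]; apply/funext => p; apply/funext => q.
have pos u v w : 0 < u -> 0 < v -> 0 < w -> 0 < lin_form u v w p q.
  by move=> u0 v0 w0; rewrite ltr_wpDr ?ltr_wpDr// mulr_ge0// ltW.
rewrite /zeta_grid opprK mulr_natl cexpMn cexp_real expRD !lnK ?posrE ?pos//.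
by rewrite /power_grid /= !rmorphM !rmorphD !rmorphM !rmorph_nat.
Qed.

End FiniteSupport.

(** * The zeta function of a cone: continuation, special values, rationality *)

Theorem theorem3p1 (R : realType) (k : fieldExtType rat)
  (k_quadratic : \dim {:k} = 2%N)
  (iota1 iota2 : {rmorphism k -> R})
  (iota_neq : exists x, iota1 x <> iota2 x)
  (I : set k) (I_ideal : fractional_ideal I)
  (xi : k -> R[i]) (xi_char : torsion_character I xi)
  (ann_neq : annihilator I xi <> ring_of_integers k)
  (f : nat) (f_gt0 : (0 < f)%N)
  (f_def : [set n : int | annihilator I xi n%:~R] =
           [set f%:Z * n | n in [set: int]])
  (t1 t2 : k) (t1I : I t1) (t2I : I t2)
  (t1_pos : totally_positive iota1 iota2 t1)
  (t2_pos : totally_positive iota1 iota2 t2)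
  (t_free : free [:: t1; t2])
  (xi_t1 : xi t1 <> 1) (xi_t2 : xi t2 <> 1)
  (A : set k) (A_coset : lattice_coset I t1 t2 A) :
  (forall s : R[i], 1 < complex.Re s ->
     abs_summable (A `&` cone t1 t2) (zeta_term iota1 iota2 xi s)) /\
  exists Z : R[i] -> R[i],
    [/\ meromorphic Z,
        forall s : R[i], 1 < complex.Re s ->
          has_sum (A `&` cone t1 t2) (zeta_term iota1 iota2 xi s) (Z s),
        forall m : int, m <= 0 ->
          analytic_at Z m%:~R /\
          forall ia ib : {rmorphism k -> R},
            (ia, ib) = (iota1, iota2) \/ (ia, ib) = (iota2, iota1) ->
            Z m%:~R =
            iter `|m|%N (@fps2_Delta _) (shintani_series ia ib xi A t1 t2) 0%N 0%N
      & forall m : int, m <= 0 -> in_cyclotomic_field f (Z m%:~R)].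
Proof.
pose at_ := coset_repr A t1 t2.
have atI : I at_.
  have := coset_repr_mem k_quadratic t_free A_coset; rewrite -/at_.
  case: A_coset => a0 a0I -> [p _ [q _ <-]].
  by do 2!apply: (idealD I_ideal) => //; exact: idealMz.
(* The strict inequality [0 < l] in the parallelogram makes the representative strictly positive. *)
have at_pos (i : {rmorphism k -> R}) : 0 < i t1 -> 0 < i t2 -> 0 < i at_.
  have [l [m [/andP[l0 _] /andP[m0 _]]]] := coset_repr_coord k_quadratic t_free A_coset.
  rewrite -/at_ => -> p1 p2; rewrite rmorphD !rmorphZ_num.
  by apply: ltr_wpDr; [apply: mulr_ge0; rewrite ?ler0q// ltW|rewrite mulr_gt0// ltr0q].
have [[a_gt0 b_gt0] [c_gt0 d_gt0]] := (t1_pos, t2_pos).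
have pos : [/\ 0 < iota1 at_, 0 < iota1 t1, 0 < iota1 t2 &
    [/\ 0 < iota2 at_, 0 < iota2 t1 & 0 < iota2 t2]].
  by split; rewrite ?at_pos//; split; rewrite ?at_pos.
have [n1 n2] := (normc_char xi_char t1I, normc_char xi_char t2I).
have [/eqP z11 /eqP z21] := (xi_t1, xi_t2).
pose pt := cone_point A t1 t2.
have iotaE (i : {rmorphism k -> R}) p q : i (pt p q) = lin_form (i at_) (i t1) (i t2) p q.
  by rewrite !rmorphD !rmorphMn /= /lin_form !mulr_natr addrAC.
have xiE p q : xi (pt p q) = xi at_ * (xi t1 ^+ p * xi t2 ^+ q).
  have [I1 I2] := (idealMn I_ideal p t1I, idealMn I_ideal q t2I).
  rewrite !(tchar_add xi_char) ?(charMn I_ideal xi_char) ?mulrA//.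
  exact: idealD.
pose grid := zeta_grid (iota1 at_) (iota1 t1) (iota1 t2) (iota2 at_) (iota2 t1) (iota2 t2).
have lin_gt0 (i : {rmorphism k -> R}) p q : 0 < i t1 -> 0 < i t2 ->
    0 < lin_form (i at_) (i t1) (i t2) p q.
  by move=> p1 p2; do 2!(apply: ltr_wpDr; first by rewrite mulr_ge0// ltW); exact: at_pos.
have termE s p q : zeta_term iota1 iota2 xi s (pt p q) =
    xi at_ * twist (xi t1) (xi t2) (grid s) p q.
  rewrite /zeta_term xiE cpow_cexp -cexpN !iotaE lnM ?posrE ?lin_gt0//.
  by rewrite /twist !mulrA -mulNr.
have pt_inj := @cone_point_inj _ A t1 t2 t_free.
have pt_mem := cone_point_mem k_quadratic t_free A_coset.
have pt_onto := cone_pointP k_quadratic t_free A_coset.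
have l1_term s : 1 < complex.Re s -> l1 (fun p q => zeta_term iota1 iota2 xi s (pt p q)).
  move=> s1; apply: le_l1 (l1M (xi at_) (l1_zeta_grid pos s1)) => p q.
  by rewrite [leRHS]Normc.normcM termE [leLHS]Normc.normcM normc_twist// lexx.
split=> [s s1|]; first exact: (abs_summable_l1 (g := zeta_term iota1 iota2 xi s) pt_inj pt_onto (l1_term s s1)).
(* A regularized value is chosen for each [s]; by uniqueness the choice is forced. *)
have [Zr HZ] := choice (reg_sum_zeta_grid_ex pos n1 n2 z11 z21).
have analytic z : analytic_at (fun s => xi at_ * Zr s) z.
  apply: derivable_analytic => s.
  by apply: derivable_scale; apply: (derivable_reg_zeta pos n1 n2 z11 z21); exact: HZ.
have value M (ia ib : {rmorphism k -> R}) :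
    (ia, ib) = (iota1, iota2) \/ (ia, ib) = (iota2, iota1) ->
    Zr (- M%:R) = Delta_coef0 M (shintani_fps
      ((ia t1)%:C%C, (ib t1)%:C%C) ((ia t2)%:C%C, (ib t2)%:C%C)
      ((ia at_)%:C%C, (ib at_)%:C%C) (xi t1) (xi t2)).
  move=> iaib; apply: (reg_sum_uniq z11 z21 (HZ _)); rewrite zeta_grid_power_grid//.
  have -> : power_grid ((iota1 t1)%:C%C, (iota2 t1)%:C%C) ((iota1 t2)%:C%C, (iota2 t2)%:C%C)
      ((iota1 at_)%:C%C, (iota2 at_)%:C%C) M =
    power_grid ((ia t1)%:C%C, (ib t1)%:C%C) ((ia t2)%:C%C, (ib t2)%:C%C)
      ((ia at_)%:C%C, (ib at_)%:C%C) M.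
    (* Exchanging the embeddings exchanges the two factors of the norm, so the grid, and with it the
       regularized sum, stays the same. *)
    case: iaib => [[-> ->]//|[-> ->]]; apply/funext => p; apply/funext => q.
    by rewrite /power_grid mulrC.
  exact: reg_sum_power_grid.
have nonpos (m : int) : m <= 0 -> exists M : nat, m = - M%:Z.
  by move=> m0; exists `|m|%N; clear -m0; lia.
exists (fun s => xi at_ * Zr s); split.
(* The continuation is entire, so the alternative of a pole never occurs. *)
- by move=> z; left.
- move=> s s1; apply: (has_sum_dsum (g := zeta_term iota1 iota2 xi s) pt_inj pt_mem pt_onto (l1_term s s1)).
  have := dsum_cvgM (xi at_) (reg_sum_zeta_grid pos n1 n2 z11 z21 s1 (HZ s)).
  by apply: dsum_cvg_ext => p q; rewrite termE.
- move=> m /nonpos[M ->]; split=> // ia ib iaib.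
  rewrite abszN absz_nat rmorphN /= -pmulrn (value _ _ _ iaib).
  by rewrite /shintani_series fps2_mulC -/(Delta_coef0 M _) Delta_coef0M.
move=> m /nonpos[M ->] S S_closed S_mu; rewrite rmorphN /= -pmulrn.
have xiS x : I x -> xi x \in S by move=> Ix; apply: S_mu; exact: (char_conductor I_ideal xi_char f_def Ix).
apply: divring_closedM => //; first exact: xiS.
have c0 : ((1 - xi t1) * (1 - xi t2)) ^+ (M.+1 + M.+1) != 0.
  by rewrite expf_neq0// mulf_neq0// subr_eq0 eq_sym.
(* The value is the finite sum of twisted differences divided by [((1 - z1)(1 - z2)) ^+ J]; it
   remains to see that every ingredient lies in [S]. *)
rewrite (value M _ _ (or_introl erefl)) -[Delta_coef0 _ _](mulKf c0) -rsum_iter_power_grid//.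
apply: divring_closedM => //.
  apply: divring_closedV => //; apply: divring_closedX => //.
  by apply: divring_closedM => //; apply: divring_closedB => //;
    rewrite ?divring_closed1// xiS.
apply: divring_closed_rsum => // p q; apply: divring_closedM => //.
  by apply: divring_closedM => //; apply: divring_closedX => //; exact: xiS.
apply: divring_closed_bdiff12 => // p' q'.
(* The entries of the grid are powers of norms of cone points, hence rational. *)
rewrite -zeta_grid_power_grid// /zeta_grid opprK mulr_natl cexpMn cexp_real.
apply: divring_closedX => //; rewrite expRD !lnK ?posrE ?lin_gt0// -!iotaE.
have [r ->] := norm_rational k_quadratic iota_neq (pt p' q').
by rewrite (fmorph_rat (real_complex R)); exact: divring_closed_rat.
Qed.
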